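(* Let $\mathcal{I}=(I_n)_{n\in\mathbb{N}}$ be a filtration of graded ideals that is $\mathrm{Inc}(\mathbb{N})^i$-invariant (for some integer $i\ge0$) or $\mathrm{Sym}(\infty)$-invariant. Then there are integers $A,B,M,L$ with $0\le A\le c$, $M\ge0$, and $L\ge0$ such that, for all $n\gg0$, $$\dim K[X_n]/I_n=An+B,$$ and the limit of $\frac{\deg I_n}{M^n\cdot n^L}$ as $n\to\infty$ exists and is equal to a positive rational number.
   Context: $K$ is an arbitrary field, $c\ge 1$ a fixed integer, $\mathbb{N}=\{1,2,\ldots\}$. For $n\in\mathbb{N}$ let $X_n=\{x_{j,k}\mid 1\le j\le c,\ 1\le k\le n\}$ and $X=\bigcup_{n\ge1}X_n$; $K[X_n]\subset K[X]$ are the polynomial rings over $K$ with the standard grading. $\mathrm{Inc}(\mathbb{N})$ is the monoid of strictly increasing functions $\mathbb{N}\to\mathbb{N}$; for $i\ge 0$, $\mathrm{Inc}(\mathbb{N})^i=\{\pi\in\mathrm{Inc}(\mathbb{N})\mid \pi(j)=j \text{ for all } j\le i\}$. $\mathrm{Sym}(n)$ is the group of bijections of $\{1,\ldots,n\}$, embedded in $\mathrm{Sym}(n+1)$ as the stabilizer of $n+1$, and $\mathrm{Sym}(\infty)=\bigcup_n\mathrm{Sym}(n)$. Both act on $K[X]$ by $K$-algebra homomorphisms via $\pi\cdot x_{j,k}=x_{j,\pi(k)}$. For $m\le n$ put $\mathrm{Inc}(\mathbb{N})^i_{m,n}=\{\pi\in\mathrm{Inc}(\mathbb{N})^i\mid\pi(m)\le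 n\}$. A sequence $\mathcal{I}=(I_n)_{n\in\mathbb{N}}$ of ideals $I_n\subset K[X_n]$ is an $\mathrm{Inc}(\mathbb{N})^i$-invariant filtration if, as subsets of $K[X]$, $\mathrm{Inc}(\mathbb{N})^i_{m,n}(I_m)\subset I_n$ whenever $m\le n$, and a $\mathrm{Sym}(\infty)$-invariant filtration if $\mathrm{Sym}(n)(I_m)\subseteq I_n$ whenever $m\le n$. $\dim$ denotes Krull dimension. For a graded ideal $I$ of a polynomial ring $P$ in finitely many variables over $K$, write the Hilbert series $\sum_j\dim_K[P/I]_j\,t^j$ as $g(t)/(1-t)^{\dim P/I}$ with $g(t)\in\mathbb{Z}[t]$; then $\deg I=g(1)$ is the degree (multiplicity), which is positive if $P/I\neq0$.
   Formalization: All ideals I_n are assumed proper; if some I_m = K[X_m], then I_n = K[X_n] for all n ≥ m, so deg I_n = 0 and the limit cannot be a positive rational number. *)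

(* Defs.v *)
From HB Require Import structures.
From mathcomp Require Import all_boot all_order all_fingroup all_algebra.
From mathcomp Require Import mpoly.
Set Implicit Arguments.
Unset Strict Implicit.
Unset Printing Implicit Defensive.
Import GRing.Theory.
Local Open Scope ring_scope.

(* In MathComp, [prime_idealr R] consists of proper ideals. *)
Definition prime_chain (R : comNzRingType) (r : nat) : Prop :=
  exists p : 'I_r.+1 -> prime_idealr R,
    forall a b : 'I_r.+1, (a < b)%N ->
      {subset p a <= p b} /\ exists2 x, x \in p b & x \notin p a.

(* The Krull dimension of R exists as a natural number and equals d. *)
Definition krull_dim (R : comNzRingType) (d : nat) : Prop :=
  prime_chain R d /\ forall r, prime_chain R r -> (r <= d)%N.

Section Graded.
Variables (K : fieldType) (N : nat).

(* An [idealr] is by definition a proper ideal, so that P/I is never the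
   zero ring (for which the degree would be 0). *)
Implicit Type I : idealr {mpoly K[N]}.

Definition graded_ideal I : Prop :=
  forall (j : nat) (p : {mpoly K[N]}), p \in I -> pihomog mdeg j p \in I.

(* dim_K [P/I]_j = h: the classes of some homogeneous b_0, ..., b_(h-1) of
   degree j form a K-basis of [P/I]_j, the image of P_j in P/I. *)
Definition graded_dim I (j h : nat) : Prop :=
  exists b : 'I_h -> {mpoly K[N]},
    [/\ forall s, b s \is j.-homog,
        forall a : 'I_h -> K,
          \pi_{ideal_quot I}%qT (\sum_s a s *: b s) = 0 -> forall s, a s = 0
      & forall p : {mpoly K[N]}, p \is j.-homog ->
          exists a : 'I_h -> K,
            \pi_{ideal_quot I}%qT p = \pi_{ideal_quot I}%qT (\sum_s a s *: b s)].

(* deg I = e.  The condition on g says, coefficient by coefficient, that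
   (1 - t)^d * (\sum_j h_j t^j) = g(t) as formal power series, where
   d = dim P/I. *)
Definition ideal_degree I (e : int) : Prop :=
  exists (d : nat) (h : nat -> nat) (g : {poly int}),
    [/\ krull_dim {ideal_quot I} d,
        forall j, graded_dim I j (h j),
        forall k, \sum_(s < k.+1) ((1 - 'X : {poly int}) ^+ d)`_s
                                    * (h (k - s)%N)%:Z = g`_k
      & e = g.[1]].

End Graded.

(* K[X_n] is {mpoly K[nvars c n]}: its variables are numbered by the pairs
   (j, k) in 'I_c * 'I_n.  All indices are counted from 0, so that 'I_n stands
   for {1, ..., n}. *)
Definition nvars (c n : nat) : nat := #|{: 'I_c * 'I_n}|.

Section Action.
Variables (K : fieldType) (c : nat).

(* The K-algebra homomorphism K[X_m] -> K[X_n] with x_{j,k} |-> x_{j,f k}.  For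
   f the restriction of some pi with pi(m) <= n, it is the restriction of the
   action of pi on K[X]. *)
Definition act (m n : nat) (f : 'I_m -> 'I_n) (p : {mpoly K[nvars c m]}) :
    {mpoly K[nvars c n]} :=
  p \mPo [tuple 'X_(enum_rank ((enum_val v).1, f (enum_val v).2))
         | v < nvars c m].

(* With indices counted from 0, pi fixes 1, ..., i iff pi j = j for all j < i *)
Definition inc_monoid (i : nat) (pi : nat -> nat) : Prop :=
  {homo pi : a b / (a < b)%N} /\ forall j, (j < i)%N -> pi j = j.

Implicit Type I : forall n, idealr {mpoly K[nvars c n]}.

(* A suitable f exists iff pi maps the first m indices to the first n ones;
   for pi increasing and m > 0 this is the condition pi(m) <= n.  The ideal
   I 0 carries no information and is not constrained. *)
Definition inc_invariant (i : nat) I : Prop :=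
  forall m n : nat, (0 < m <= n)%N ->
  forall (pi : nat -> nat) (f : 'I_m -> 'I_n),
    inc_monoid i pi -> (forall k : 'I_m, f k = pi k :> nat) ->
    forall p, p \in I m -> act f p \in I n.

Definition sym_invariant I : Prop :=
  forall (m n : nat) (le_mn : (m <= n)%N), (0 < m)%N ->
  forall (s : 'S_n) p, p \in I m -> act (s \o widen_ord le_mn) p \in I n.

End Action.

(* Main.v *)
Require Import Defs.
From HB Require Import structures.
From mathcomp Require Import all_boot all_order all_algebra.
From mathcomp Require Import mpoly.
From mathcomp Require Import reals topology normedtype sequences.
From mathcomp Require Import perm zify ring lra boolp.
Set Implicit Arguments.
Unset Strict Implicit.
Unset Printing Implicit Defensive.
Import Order.TTheory GRing.Theory Num.Theory.
Import numFieldNormedType.Exports.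

(* Passing to leading monomials does not change Hilbert functions, and it turns
   the filtration into a set of words over N^c (the k-th letter of a monomial of
   K[X_n] collects the exponents of x_{1,k}, ..., x_{c,k}) which is upward closed
   for the Higman order with the first i letters kept in place. By Higman's
   lemma it is generated by finitely many words. Reading a word letter by letter
   and keeping track of the unmatched parts of these generators gives a
   deterministic automaton whose only cycles are loops, so that the Hilbert
   series of the words avoiding the generators satisfy recurrences
   H_(n+1) = l H_n + Y_n with l the Hilbert series of a set of letters. Following
   the order of the pole at t = 1 and its leading coefficient through these
   recurrences gives orders A n + B and coefficients that are exponential
   polynomials in n.

   The order of the pole is the Krull dimension. It bounds lengths of chains
   p_0 < ... < p_r, because elements f_i of p_i not in p_(i-1) are algebraically
   independent modulo p_0. It is attained, because an ideal that is maximal among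
   the graded ideals whose quotient has growth of order at least d is prime, and
   adding to it a homogeneous element of positive degree lowers the growth by at
   most one. *)

(** * Well-quasi-orders *)

(** The limit could fail to exist through a periodic factor in the leading coefficients or through
    cancellation of leading terms. Since the only cycles are loops, each state obeys a first-order
    recurrence with a multiplier that is a natural number, and no other root of unity than 1 can
    enter. Since Hilbert functions are nonnegative, every pole has a positive leading coefficient; a
    sum never loses its larger pole, and the orders obey a max-plus recurrence.

    Taking leading monomials commutes with a renaming of variables only if the renaming is
    increasing. The variable (j, k) has number j n + k, so strictly increasing maps of the second
    index qualify. Permutations do not; the symmetric case is reached because an increasing map
    agrees with a permutation on finitely many indices.

    The ideals met while building a chain of primes are compared by growth bounds alone, so that no
    pole has to be computed for them. *)

Definition wqo (T : Type) (A : T -> Prop) (le : T -> T -> bool) : Prop :=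
  forall f : nat -> T, (forall i, A (f i)) -> exists i j, (i < j)%N /\ le (f i) (f j).

(** Only finitely many terms have no larger later term, since infinitely many of them would form a
    bad sequence. Past the last one, a larger later term can always be chosen. *)
Lemma wqo_monotone_subseq (T : Type) (A : T -> Prop) (le : T -> T -> bool) :
  transitive le -> wqo A le -> forall f : nat -> T, (forall i, A (f i)) ->
  exists g : nat -> nat, {homo g : i j / (i < j)%N} /\
    forall i j, (i < j)%N -> le (f (g i)) (f (g j)).
Proof.
move=> le_tr wA f Af.
have [N HN] : exists N, forall i, (N <= i)%N -> exists j, (i < j)%N && le (f i) (f j).
  apply: contrapT => noN.
  have nxt : forall N, exists i, (N <= i)%N /\ forall j, (i < j)%N -> ~~ le (f i) (f j).
    move=> N; apply: contrapT => H; apply: noN; exists N => i Ni.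
    apply: contrapT => Hi; apply: H; exists i; split => // j ij.
    by apply/negP => lij; apply: Hi; exists j; rewrite ij.
  have [s Hs] := choice nxt.
  pose t := fix t n := if n is n'.+1 then s (t n').+1 else s 0%N.
  have tS n : (t n < t n.+1)%N by exact: (Hs _).1.
  have tP n j : (t n < j)%N -> ~~ le (f (t n)) (f j).
    by case: n => [|n] /=; apply: (Hs _).2.
  have tinc : {homo t : i j / (i < j)%N} by apply: homo_ltn => // ? ? ?; apply: ltn_trans.
  have [i [j [ij lij]]] := wA (f \o t) (fun i => Af (t i)).
  by move: (tP i (t j) (tinc _ _ ij)); rewrite lij.
have nxt : forall i, exists j, (N <= i)%N -> (i < j)%N && le (f i) (f j).
  move=> i; case: (leqP N i) => Ni; last by exists 0%N.
  by have [j Hj] := HN _ Ni; exists j.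
have [s Hs] := choice nxt.
pose g := fix g n := if n is n'.+1 then s (g n') else N.
have gN n : (N <= g n)%N.
  elim: n => //= n IH; have /andP[/ltnW H _] := Hs _ IH; exact: leq_trans H.
have gS n : (g n < g n.+1)%N by have /andP[] := Hs _ (gN n).
exists g; split; first by apply: homo_ltn => // ? ? ?; apply: ltn_trans.
apply: (@homo_ltn _ (fun n => f (g n)) (fun x y => le x y)).
- by move=> y x z; apply: le_tr.
- by move=> i; have /andP[] := Hs _ (gN i).
Qed.

Lemma wqo_nat : wqo (fun _ => True) leq.
Proof.
move=> f _; apply: contrapT => H.
have fS i : (f i.+1 < f i)%N.
  by rewrite ltnNge; apply/negP => Hi; apply: H; exists i, i.+1.
have : forall n, (f n + n <= f 0)%N.
  elim=> [|n IH]; first by rewrite addn0.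
  by apply: leq_trans IH; rewrite addnS -addSn leq_add2r.
by move=> /(_ (f 0%N).+1); rewrite addnS ltnNge leq_addl.
Qed.

Lemma wqo_pair (T1 T2 : Type) (A1 : T1 -> Prop) (A2 : T2 -> Prop)
    (le1 : T1 -> T1 -> bool) (le2 : T2 -> T2 -> bool) :
  transitive le1 -> wqo A1 le1 -> wqo A2 le2 ->
  forall (f1 : nat -> T1) (f2 : nat -> T2), (forall i, A1 (f1 i)) -> (forall i, A2 (f2 i)) ->
  exists i j, [/\ (i < j)%N, le1 (f1 i) (f1 j) & le2 (f2 i) (f2 j)].
Proof.
move=> tr1 w1 w2 f1 f2 H1 H2.
have [g [gi gl]] := wqo_monotone_subseq tr1 w1 H1.
have [i [j [ij lij]]] := w2 (f2 \o g) (fun i => H2 (g i)).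
by exists (g i), (g j); split; [apply: gi|apply: gl|].
Qed.

Definition lew (a b : seq nat) := all2 leq a b.

Lemma lew_trans : transitive lew.
Proof.
rewrite /lew; elim=> [|y t IH] [|x s] [|z u] //= /andP[xy st] /andP[yz tu].
by rewrite (leq_trans xy yz) (IH _ _ st tu).
Qed.

Lemma dickson (c : nat) : wqo (fun b : seq nat => size b = c) lew.
Proof.
elim: c => [|c IH] f Hf.
  by exists 0%N, 1%N; split => //; rewrite (size0nil (Hf 0%N)) (size0nil (Hf 1%N)).
have ltr : transitive leq by move=> ? ? ?; apply: leq_trans.
have Hb i : size (behead (f i)) = c by rewrite size_behead Hf.
have [i [j [ij l1 l2]]] := wqo_pair ltr wqo_nat IH (f1 := fun i => head 0%N (f i))
  (f2 := fun i => behead (f i)) (fun _ => I) Hb.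
exists i, j; split => //; move: (Hf i) (Hf j) l1 l2.
by case: (f i) => // x s; case: (f j) => // y t _ _ /= l1 l2; rewrite /lew /= l1.
Qed.

(** * Higman's lemma *)

Section Embedding.
Variables (T : eqType) (le : T -> T -> bool).

(* Greedy matching of the letters of [g] in [w]; the first [k] letters have to
   be matched in place. *)
Fixpoint emb (k : nat) (g w : seq T) {struct w} : bool :=
  match g, w with
  | [::], _ => true
  | _ :: _, [::] => false
  | a :: g', b :: w' =>
      if k is k'.+1 then le a b && emb k' g' w'
      else if le a b then emb 0 g' w' else emb 0 g w'
  end.

Lemma emb0s k w : emb k [::] w. Proof. by case: w. Qed.

Lemma emb_behead a g w : emb 0 (a :: g) w -> emb 0 g w.
Proof.
elim: w a g => [|b w IH] a g //=; case: ifP => lab H.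
  case: g H => [|a' g] // H; case: ifP => // _; exact: IH H.
have H' := IH _ _ H.
case: g H H' => [|a' g] // H H'; case: ifP => // _; exact: IH H'.
Qed.

Lemma emb_cons b g w : emb 0 g w -> emb 0 g (b :: w).
Proof. by case: g => [|a g] //= H; case: ifP => // _; apply: emb_behead H. Qed.

Variable A : T -> Prop.

Definition allA (w : seq T) : Prop := forall x, x \in w -> A x.

(** Nash-Williams' argument: a bad sequence that is minimal for the lengths of its words is made
    smaller by removing first letters. *)
Lemma higman : transitive le -> wqo A le -> wqo allA (emb 0).
Proof.
move=> le_tr wA; apply: contrapT => nw.
pose bad (f : nat -> seq T) := (forall i, allA (f i)) /\ forall i j, (i < j)%N -> ~~ emb 0 (f i) (f j).
have [f0 f0bad] : exists f, bad f.
  apply: contrapT => nf; apply: nw => f Hf; apply: contrapT => H; apply: nf; exists f.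
  by split=> // i j ij; apply/negP => E; apply: H; exists i, j.
have stp : forall p : nat * (nat -> seq T), exists h', bad p.2 ->
    [/\ bad h', (forall i, (i < p.1)%N -> h' i = p.2 i) &
     forall h'', bad h'' -> (forall i, (i < p.1)%N -> h'' i = p.2 i) ->
       (size (h' p.1) <= size (h'' p.1))%N].
  case=> n h /=; case: (EM (bad h)) => [hb|]; last by exists h.
  pose P m := `[< exists h', [/\ bad h', (forall i, (i < n)%N -> h' i = h i) & size (h' n) = m] >].
  have exP : exists m, P m by exists (size (h n)); apply/asboolP; exists h.
  case: (ex_minnP exP) => m /asboolP[h' [h'b h'e h's]] mmin.
  exists h' => _; split => // h'' b'' e''; rewrite h's; apply: mmin.
  by apply/asboolP; exists h''.
have [st Hst] := choice stp.
(* Stage [n] chooses the [n]-th word as short as possible among the bad sequences that continue the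
   words already fixed. The diagonal [g] is the minimal bad sequence. *)
pose H := fix H n := if n is n'.+1 then st (n, H n') else st (0%N, f0).
have Hbad n : bad (H n).
  elim: n => [|n IH] /=; [by case: (Hst (0%N, f0) f0bad)|by case: (Hst (n.+1, H n) IH)].
have HS n i : (i <= n)%N -> H n.+1 i = H n i.
  by move=> ni; case: (Hst (n.+1, H n) (Hbad n)) => _ He _; exact: (He i ni).
have Hst' n m i : (i <= n)%N -> (n <= m)%N -> H m i = H n i.
  move=> ni /subnK <-; elim: (m - n)%N => [|k IH] //.
  by rewrite addSn HS // (leq_trans ni) // leq_addl.
pose g n := H n n.
have gbad : bad g.
  split=> [i|i j ij]; first exact: (Hbad i).1.
  by rewrite /g -(Hst' i j i) ?leqnn ?(ltnW ij) //; apply: (Hbad j).2.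
have gmin n h : bad h -> (forall i, (i < n)%N -> h i = g i) -> (size (g n) <= size (h n))%N.
  rewrite /g; case: n => [|n] hb he.
    by case: (Hst (0%N, f0) f0bad) => _ _ /(_ h hb) /=; apply.
  case: (Hst (n.+1, H n) (Hbad n)) => _ _ /(_ h hb) /=; apply => i ni.
  by rewrite he // /g -(Hst' i n i).
have gne n : exists b t, g n = b :: t.
  move: (gbad.2 n n.+1 (ltnSn n)); case: (g n) => [|b t]; first by rewrite emb0s.
  by exists b, t.
have [hd Hhd] := choice gne.
have [tl Htl] := choice Hhd.
have Ahd i : A (hd i) by apply: (gbad.1 i); rewrite Htl mem_head.
have [p [pinc ple]] := wqo_monotone_subseq le_tr wA Ahd.
(* The first [p 0] words are kept and followed by the tails along a subsequence whose heads
   increase. An embedding of tails would extend to the whole words, so [h] is bad, but its word at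
   [p 0] is too short. *)
pose h i := if (i < p 0)%N then g i else tl (p (i - p 0))%N.
suff hb : bad h.
  have := gmin (p 0%N) h hb; rewrite {2}/h ltnn subnn Htl /= => Hm.
  suff : (size (tl (p 0)) < size (tl (p 0)))%N by rewrite ltnn.
  by apply: Hm => i ip; rewrite /h ip.
have ph i : (p 0 <= p i)%N by case: i => // i; apply/ltnW/pinc.
split=> [i x|i j ij]; rewrite /h.
  case: ifP => _ Hx; first exact: (gbad.1 i).
  by apply: (gbad.1 (p (i - p 0)%N)); rewrite Htl in_cons Hx orbT.
case: ltnP => [ip|pi].
  case: ltnP => [jp|pj]; first exact: gbad.2.
  apply: contra (gbad.2 i (p (j - p 0)%N) (leq_trans ip (ph _))) => E.
  by rewrite [g (p _)]Htl; apply: emb_cons.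
rewrite ifN -?leqNgt ?(leq_trans pi (ltnW ij)) //.
have ij' : (i - p 0 < j - p 0)%N by rewrite ltn_sub2r // (leq_ltn_trans pi ij).
apply: contra (gbad.2 _ _ (pinc _ _ ij')) => E.
by rewrite !Htl /= ple.
Qed.

(** The order is a product of [k] copies of [le] with the Higman order on the remaining letters; the
    length condition supplies the [k] heads. *)
Lemma higman_rigid (k : nat) : transitive le -> wqo A le ->
  wqo (fun w => allA w /\ (k <= size w)%N) (emb k).
Proof.
move=> le_tr wA; elim: k => [|k IH] f Hf.
  by apply: higman => // i; case: (Hf i).
have fne n : exists b t, f n = b :: t.
  by case: (Hf n); case: (f n) => [|b t] // _ _; exists b, t.
have [hd Hhd] := choice fne.
have [tl Htl] := choice Hhd.
have Ahd i : A (hd i) by apply: (Hf i).1; rewrite Htl mem_head.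
have Atl i : allA (tl i) /\ (k <= size (tl i))%N.
  move: (Hf i); rewrite Htl /= ltnS => -[Hx Hs]; split => // x xt.
  by apply: Hx; rewrite in_cons xt orbT.
have [i [j [ij l1 l2]]] := wqo_pair le_tr wA IH Ahd Atl.
by exists i, j; rewrite !Htl /= l1 l2.
Qed.

End Embedding.

Lemma wqo_finite_basis (T : eqType) (A : T -> Prop) (le : T -> T -> bool) (U : T -> Prop) :
  wqo A le -> (forall x, U x -> A x) ->
  exists s : seq T, (forall x, x \in s -> U x) /\
    forall x, U x -> exists2 g, g \in s & le g x.
Proof.
move=> wA UA; apply: contrapT => H.
have nxt : forall s : seq T, exists x, (forall y, y \in s -> U y) ->
    U x /\ forall g, g \in s -> ~~ le g x.
  move=> s; case: (EM (forall y, y \in s -> U y)) => [sU|sU]; last first.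
    have [y _] : exists y : T, True; last by exists y => /sU.
    by case: s sU => [|y s] sU; [case: sU|exists y].
  apply: contrapT => H'; apply: H; exists s; split => // x Ux.
  apply: contrapT => H''; apply: H'; exists x => _; split => // g gs.
  by apply/negP => lg; apply: H''; exists g.
have [F HF] := choice nxt.
pose S := fix S n := if n is n'.+1 then F (S n') :: S n' else [::].
have SU n : forall y, y \in (S n) -> U y.
  elim: n => //= n IH y; rewrite in_cons => /predU1P[->|]; [exact: (HF _ IH).1|exact: IH].
have Sin i j : (i < j)%N -> F (S i) \in S j.
  by elim: j => // j IH; rewrite ltnS leq_eqVlt in_cons => /predU1P[->|/IH ->]; rewrite ?eqxx ?orbT.
have [p [q [pq lpq]]] := wA (fun n => F (S n)) (fun n => UA _ (HF _ (SU n)).1).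
by have := (HF _ (SU q)).2 _ (Sin _ _ pq); rewrite lpq.
Qed.

(** * Poles of Hilbert series *)

Local Open Scope ring_scope.

Section Convolution.
Variable R : comNzRingType.
Implicit Types f g h : nat -> R.

Definition conv f h (k : nat) : R := \sum_(s < k.+1) f s * h (k - s)%N.

(** Coefficients of a product of power series only see truncations; commutativity and associativity
    are thereby inherited from polynomials. *)
Lemma conv_trunc N f h k : (k < N)%N ->
  conv f h k = ((\poly_(i < N) f i) * (\poly_(i < N) h i))`_k.
Proof.
move=> kN; rewrite coefM; apply: eq_bigr => s _; rewrite !coef_poly.
by rewrite (leq_trans (ltn_ord s) kN) (leq_ltn_trans (leq_subr s k) kN).
Qed.

Lemma eq_conv f f' h h' : f =1 f' -> h =1 h' -> conv f h =1 conv f' h'.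
Proof. by move=> e1 e2 k; apply: eq_bigr => s _; rewrite e1 e2. Qed.

Lemma convC f h : conv f h =1 conv h f.
Proof. by move=> k; rewrite !(@conv_trunc k.+1) // mulrC. Qed.

Lemma convA f g h : conv f (conv g h) =1 conv (conv f g) h.
Proof.
move=> k; rewrite !(@conv_trunc k.+1) //.
have E u v : forall j, (j < k.+1)%N -> (\poly_(i < k.+1) conv u v i)`_j =
    ((\poly_(i < k.+1) u i) * (\poly_(i < k.+1) v i))`_j.
  by move=> j jk; rewrite coef_poly jk (@conv_trunc k.+1).
transitivity ((\poly_(i < k.+1) f i) * ((\poly_(i < k.+1) g i) * (\poly_(i < k.+1) h i)))`_k.
  by rewrite !coefM; apply: eq_bigr => s _; rewrite E // ltnS leq_subr.
by rewrite mulrA coefM [RHS]coefM; apply: eq_bigr => s _; rewrite E // ltn_ord.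
Qed.

Lemma convDr f g h k : conv f (fun j => g j + h j) k = conv f g k + conv f h k.
Proof. by rewrite -big_split; apply: eq_bigr => s _; rewrite mulrDr. Qed.

Lemma conv_coef (p q : {poly R}) k : conv (fun s => p`_s) (fun s => q`_s) k = (p * q)`_k.
Proof. by rewrite coefM. Qed.

Lemma conv1 h : conv (fun s => (1 : {poly R})`_s) h =1 h.
Proof.
move=> k; rewrite /conv big_ord_recl coef1 /= mul1r subn0 big1 ?addr0 // => i _.
by rewrite coef1 mul0r.
Qed.

Lemma convX1 h k : conv (fun s => (1 - 'X : {poly R})`_s) h k =
  h k - (if k is k'.+1 then h k' else 0).
Proof.
rewrite /conv big_ord_recl coefB coef1 coefX /= subr0 mul1r subn0; congr (_ + _).
case: k => [|k]; first by rewrite big_ord0 oppr0.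
rewrite big_ord_recl /= coefB coef1 coefX /= sub0r mulN1r subSS subn0.
by rewrite big1 ?addr0 // => i _; rewrite coefB coef1 coefX /= subrr mul0r.
Qed.

End Convolution.

Local Notation X1 d := (fun s : nat => (((1 - 'X) ^+ d : {poly int})`_s)).

(* The formal power series with coefficients [h] is g(t) / (1 - t)^d with
   g(1) = e positive. *)
Definition hilbert_pole (h : nat -> nat) (d e : nat) : Prop :=
  (0 < e)%N /\ exists g : {poly int}, g.[1] = e%:Z /\
    forall k, conv (X1 d) (fun j => (h j)%:Z) k = g`_k.

Lemma eq_hilbert_pole h h' d e : h =1 h' -> hilbert_pole h d e -> hilbert_pole h' d e.
Proof.
move=> E [e0 [g [g1 Hg]]]; split => //; exists g; split => // k.
by rewrite -Hg; apply: eq_conv => // j; rewrite E.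
Qed.

Lemma conv_poleW h d d' (g : {poly int}) : (d <= d')%N -> (forall k, conv (X1 d) h k = g`_k) ->
  forall k, conv (X1 d') h k = ((1 - 'X) ^+ (d' - d) * g)`_k.
Proof.
move=> le_d Hg k; rewrite -conv_coef -(eq_conv (frefl _) Hg) convA.
by apply: eq_conv => // s; rewrite conv_coef -exprD subnK.
Qed.

(** Over the common denominator, the numerator of the smaller pole acquires a factor 1 - t and
    vanishes at t = 1. *)
Lemma hilbert_poleD_lt h h' d d' e e' : (d < d')%N ->
  hilbert_pole h d e -> hilbert_pole h' d' e' -> hilbert_pole (fun j => h j + h' j)%N d' e'.
Proof.
move=> dd [e0 [g [g1 Hg]]] [e0' [g' [g1' Hg']]]; split => //.
exists ((1 - 'X) ^+ (d' - d) * g + g'); split=> [|k].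
  rewrite hornerD hornerM horner_exp !hornerE subrr expr0n subn_eq0 leqNgt dd /=.
  by rewrite mul0r add0r.
rewrite coefD -(conv_poleW (ltnW dd) Hg) -Hg' -convDr.
by apply: eq_conv => // j; rewrite PoszD.
Qed.

Lemma hilbert_poleD h h' d e e' :
  hilbert_pole h d e -> hilbert_pole h' d e' -> hilbert_pole (fun j => h j + h' j)%N d (e + e').
Proof.
move=> [e0 [g [g1 Hg]]] [e0' [g' [g1' Hg']]]; split; first by rewrite addn_gt0 e0.
exists (g + g'); split=> [|k]; first by rewrite hornerD g1 g1'.
by rewrite coefD -Hg -Hg' -convDr; apply: eq_conv => // j; rewrite PoszD.
Qed.

Definition convn (h h' : nat -> nat) (k : nat) : nat := (\sum_(s < k.+1) h s * h' (k - s))%N.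

Lemma Posz_convn h h' k : (convn h h' k)%:Z = conv (fun j => (h j)%:Z) (fun j => (h' j)%:Z) k.
Proof. by rewrite -[LHS]natz natr_sum; apply: eq_bigr => s _; rewrite natz PoszM. Qed.

Lemma hilbert_poleM h h' d d' e e' :
  hilbert_pole h d e -> hilbert_pole h' d' e' -> hilbert_pole (convn h h') (d + d') (e * e').
Proof.
move=> [e0 [g [g1 Hg]]] [e0' [g' [g1' Hg']]]; split; first by rewrite muln_gt0 e0.
exists (g * g'); split=> [|k]; first by rewrite hornerM g1 g1'.
rewrite -conv_coef -(eq_conv Hg Hg').
set u := X1 d; set v := X1 d'; set a := fun j => (h j)%:Z; set b := fun j => (h' j)%:Z.
transitivity (conv (conv u v) (conv a b) k).
  by apply: eq_conv => s; rewrite ?conv_coef -?exprD ?Posz_convn.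
rewrite -!convA; apply: eq_conv => // s.
by rewrite !convA; apply: eq_conv => // t; rewrite convC.
Qed.

Lemma hilbert_pole_delta i : hilbert_pole (fun j => (j == i) : nat) 0 1.
Proof.
split => //; exists 'X^i; split=> [|k]; first by rewrite hornerXn expr1n.
by rewrite expr0 conv1 coefXn natz.
Qed.

Lemma hilbert_pole_one : hilbert_pole (fun _ => 1%N) 1 1.
Proof.
split => //; exists 1; split=> [|k]; first by rewrite hornerC.
by rewrite expr1 convX1 coef1; case: k => [|k]; rewrite ?subr0 ?subrr.
Qed.

(** A discrete mean value bound for x^(d+1); telescoped, it bounds sums of d-th powers from
    below. *)
Lemma expSn_le d x : (x.+1 ^ d.+1 <= x ^ d.+1 + d.+1 * x.+1 ^ d)%N.
Proof.
elim: d => [|d IH]; first by rewrite !expn1 expn0 muln1 addn1.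
rewrite expnS [(x ^ d.+2)%N]expnS; move: IH; rewrite (expnS x.+1 d).
move: (x.+1 ^ d)%N (x ^ d.+1)%N => B X IH.
have H1 : (x * (x.+1 * B) <= x * (X + d.+1 * B))%N by rewrite leq_mul2l IH orbT.
have H2 : (x * (d.+1 * B) <= d.+1 * (x.+1 * B))%N by rewrite mulnCA leq_mul2l leq_mul2r leqnSn !orbT.
move: H1 H2; rewrite mulnDr !mulSn; lia.
Qed.

Lemma expn_le_sum d k : (k ^ d.+1 <= d.+1 * \sum_(j < k) j.+1 ^ d)%N.
Proof.
elim: k => [|k IH]; first by rewrite exp0n.
rewrite big_ord_recr /= mulnDr.
by apply: leq_trans (expSn_le _ _) _; rewrite leq_add2r.
Qed.

Lemma leq_expl m n d : (m <= n)%N -> (m ^ d <= n ^ d)%N.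
Proof. by case: d => // d mn; rewrite leq_exp2r. Qed.

(** * Pole order and growth of partial sums *)

Definition psum (h : nat -> int) (k : nat) : int := \sum_(j < k.+1) h j.

Lemma psum_conv h k : psum (conv (fun s => (1 - 'X : {poly int})`_s) h) k = h k.
Proof.
elim: k => [|k IH]; first by rewrite /psum big_ord1 convX1 subr0.
by rewrite /psum big_ord_recr /= -/(psum _ k) IH convX1 addrCA subrr addr0.
Qed.

(** Induction on the order: the partial sums of (1 - t) h are the values of h, so bounds on them,
    summed once more, bound the partial sums of h. For order 0 the partial sums are eventually
    g(1). *)
Lemma pole_growth d h (g : {poly int}) : (forall k, conv (X1 d) h k = g`_k) ->
  (exists C : nat, forall k, `|psum h k| <= (C * k.+1 ^ d)%N%:Z) /\
  (0 < g.[1] -> exists C k0 : nat, forall k, (k0 <= k)%N -> (k.+1 ^ d)%N%:Z <= C%:Z * psum h k).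
Proof.
elim: d h => [|d IH] h Hg.
  have hg : h =1 fun k => g`_k by move=> k; rewrite -Hg expr0 conv1.
  have Eg k : (size g <= k)%N -> psum h k = g.[1].
    move=> sk; rewrite horner_coef.
    transitivity (\sum_(i < size g) g`_i); last by apply: eq_bigr => i _; rewrite expr1n mulr1.
    transitivity (\sum_(i < k.+1) g`_i); first by apply: eq_bigr => i _; rewrite hg.
    rewrite -(subnKC (leqW sk)) big_split_ord /= [X in _ + X]big1 ?addr0 // => i _.
    by rewrite nth_default // leq_addr.
  split.
    exists (\sum_(i < size g) absz (g`_i)%R)%N => k; rewrite expn0 muln1.
    apply: le_trans (ler_norm_sum _ _ _) _.
    have -> : \sum_(i < k.+1) `|h i| = (\sum_(i < k.+1) absz (g`_i)%R)%N%:Z.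
      rewrite -[RHS]natz natr_sum.
      by apply: eq_bigr => i _; rewrite hg natz abszE.
    rewrite lez_nat; case: (leqP (size g) k.+1) => sk.
      rewrite -(subnKC sk) big_split_ord /= [X in (_ + X)%N]big1 ?addn0 // => i _.
      by rewrite nth_default // leq_addr.
    by rewrite -(subnKC (ltnW sk)) big_split_ord /= leq_addr.
  move=> g0; exists 1%N, (size g) => k sk; rewrite expn0 mul1r Eg //; lia.
pose h' := conv (fun s => (1 - 'X : {poly int})`_s) h.
have Hg' k : conv (X1 d) h' k = g`_k.
  by rewrite -Hg /h' convA; apply: eq_conv => // s; rewrite conv_coef -exprSr.
have [[C HC] low] := IH h' Hg'.
have hh k : psum h' k = h k by exact: psum_conv.
split.
  exists C => k; apply: le_trans (ler_norm_sum _ _ _) _.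
  have -> : (C * k.+1 ^ d.+1)%N%:Z = \sum_(i < k.+1) (C * k.+1 ^ d)%N%:Z.
    by rewrite sumr_const card_ord -mulr_natl natz -PoszM expnS mulnCA.
  apply: ler_sum => i _; rewrite -hh; apply: le_trans (HC _) _.
  by rewrite lez_nat leq_mul2l leq_expl ?orbT // ltn_ord.
move=> g0; have {low}[C' [k0 low]] := low g0.
pose D : nat := (C' * absz (psum h k0) + \sum_(j < k0.+1) j.+1 ^ d)%N.
have L1 k : (k0 <= k)%N -> (\sum_(j < k.+1) j.+1 ^ d)%N%:Z <= C'%:Z * psum h k + D%:Z.
  elim: k => [|k IHk].
    by rewrite leqn0 => /eqP k00; rewrite /D k00; nia.
  rewrite leq_eqVlt => /predU1P[<-|]; first by rewrite /D; nia.
  rewrite ltnS => kk; have := IHk kk; have := low k.+1 (leqW kk).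
  have -> : psum h k.+1 = psum h k + h k.+1 by rewrite /psum big_ord_recr.
  rewrite hh mulrDr => h1 h2.
  rewrite big_ord_recr PoszD addrAC; exact: lerD.
(* From this index on, [d.+1 * D] is at most half of [k.+1 ^ d.+1]; the other half is what the
   factor 2 in the constant pays for. *)
exists (2 * d.+1 * C')%N, (k0 + 2 * d.+1 * D)%N => k kk.
have := L1 k (leq_trans (leq_addr _ _) kk).
have := expn_le_sum d k.+1.
have : (k.+1 <= k.+1 ^ d.+1)%N by rewrite -{1}(expn1 k.+1) leq_pexp2l.
move: (psum h k) (k.+1 ^ d.+1)%N (\sum_(j < k.+1) j.+1 ^ d)%N => P E S h1 h2 h3.
have h4 : (2 * d.+1 * D <= E)%N by apply: leq_trans h1; lia.
have h5 : (d.+1 * S)%N%:Z <= d.+1%:Z * (C'%:Z * P + D%:Z) by rewrite PoszM ler_wpM2l.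
have h6 : (2 * E)%N%:Z <= 2%:Z * (d.+1%:Z * (C'%:Z * P + D%:Z)) by lia.
nia.
Qed.

Definition nsum (h : nat -> nat) (k : nat) : nat := (\sum_(j < k.+1) h j)%N.

(* For [d = 0] this says that [H] vanishes. *)
Definition growth_lt (H : nat -> nat) (d : nat) : Prop :=
  exists C : nat, forall k, (k.+1 * H k <= C * k.+1 ^ d)%N.

Lemma psum_nat h k : psum (fun j => (h j)%:Z) k = (nsum h k)%:Z.
Proof. by rewrite /nsum -[RHS]natz natr_sum; apply: eq_bigr => i _; rewrite natz. Qed.

Lemma hilbert_pole_upper h d e : hilbert_pole h d e ->
  exists C : nat, forall k, (nsum h k <= C * k.+1 ^ d)%N.
Proof.
move=> [_ [g [_ Hg]]]; have [[C HC] _] := pole_growth Hg.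
by exists C => k; have := HC k; rewrite psum_nat; lia.
Qed.

Lemma hilbert_pole_lower h d e : hilbert_pole h d e -> ~ growth_lt (nsum h) d.
Proof.
move=> [e0 [g [g1 Hg]]] [C' HC']; have [_ low] := pole_growth Hg.
have [|C [k0 HC]] := low; first by rewrite g1; lia.
(* At an index at least [C' * C], the upper bound forces [k.+1 <= C' * C]. *)
have := HC (k0 + C' * C)%N (leq_addr _ _); have := HC' (k0 + C' * C)%N.
rewrite psum_nat; set k := (k0 + _)%N.
have : (0 < k.+1 ^ d)%N by rewrite expn_gt0.
have : (C' * C <= k)%N by rewrite leq_addl.
move: (k.+1 ^ d)%N (nsum h k) => E P h1 h2 h3 h4.
have h5 : (E <= C * P)%N by lia.
have h6 : (k.+1 * P <= C' * (C * P))%N by apply: leq_trans h3 _; rewrite leq_mul2l h5 orbT.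
have : (0 < P)%N by nia.
nia.
Qed.

Local Close Scope ring_scope.

(** * Counting by degree *)

(** [h] is the Hilbert function of [A]. Listing each degree without repetition expresses finiteness
    while [T] may be infinite. *)
Definition counts (T : eqType) (deg : T -> nat) (A : pred T) (h : nat -> nat) : Prop :=
  forall j, exists s : seq T,
    [/\ uniq s, forall x, (x \in s) = A x && (deg x == j) & size s = h j].

Section Hilb.
Variables (T : eqType) (deg : T -> nat).
Implicit Types (A B : pred T) (h : nat -> nat).

Lemma counts_ext A B h : A =1 B -> counts deg A h -> counts deg B h.
Proof.
by move=> E H j; have [s [us ms zs]] := H j; exists s; split => // x; rewrite ms E.
Qed.

Lemma counts0 : counts deg pred0 (fun _ => 0).
Proof. by move=> j; exists [::]. Qed.

Lemma counts_zero A h : counts deg A h -> A =1 pred0 -> forall j, h j = 0.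
Proof.
move=> H E j; have [s [us ms <-]] := H j; apply/eqP; rewrite size_eq0.
by case: s us ms => // x s _ /(_ x); rewrite mem_head E.
Qed.

Lemma counts_nonzero A h x : counts deg A h -> A x -> 0 < h (deg x).
Proof.
move=> H Ax; have [s [us ms <-]] := H (deg x).
by rewrite lt0n size_eq0; apply: contraTneq Ax => s0; move: (ms x); rewrite s0 eqxx andbT => <-.
Qed.

Lemma countsU A B h h' : (forall x, A x -> ~~ B x) -> counts deg A h -> counts deg B h' ->
  counts deg (predU A B) (fun j => h j + h' j).
Proof.
move=> dis HA HB j; have [s [us ms zs]] := HA j; have [t [ut mt zt]] := HB j.
exists (s ++ t); split=> [|x|]; last by rewrite size_cat zs zt.
  rewrite cat_uniq us ut andbT /=; apply/hasPn => x; rewrite mt ms => /andP[Bx _].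
  by apply/nandP; left; apply: contraL Bx; apply: dis.
by rewrite mem_cat ms mt -andb_orl.
Qed.

Lemma counts_bij (T' : eqType) (deg' : T' -> nat) (f : T -> T') A (B : pred T') h :
  (forall x y, A x -> A y -> f x = f y -> x = y) ->
  (forall x, A x -> B (f x) /\ deg' (f x) = deg x) ->
  (forall y, B y -> exists2 x, A x & y = f x) ->
  counts deg A h -> counts deg' B h.
Proof.
move=> fi fA fB H j; have [s [us ms zs]] := H j.
have sA x : x \in s -> A x by rewrite ms => /andP[].
exists (map f s); split=> [|y|]; last by rewrite size_map.
  by rewrite map_inj_in_uniq // => x y /sA Ax /sA Ay; apply: fi.
apply/mapP/andP => [[x]|[/fB[x Ax ->]]].
  by rewrite ms => /andP[Ax /eqP dx] ->; have [-> ->] := fA _ Ax; rewrite dx.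
by rewrite (fA _ Ax).2 => dx; exists x => //; rewrite ms Ax.
Qed.

Lemma counts_prefix A h k : counts deg A h -> exists s : seq T,
  [/\ uniq s, forall x, (x \in s) = A x && (deg x < k) &
   forall F : nat -> nat, \sum_(x <- s) F (deg x) = \sum_(i < k) h i * F i].
Proof.
move=> H; elim: k => [|k [s [us ms zs]]].
  by exists [::]; split=> [|x|F] //; rewrite ?ltn0 ?andbF // big_nil big_ord0.
have [t [ut mt zt]] := H k; exists (s ++ t); split=> [|x|F].
- rewrite cat_uniq us ut andbT; apply/hasPn => x; rewrite mt ms => /andP[_ /eqP->].
  by rewrite ltnn andbF.
- by rewrite mem_cat ms mt ltnS [deg x <= k]leq_eqVlt andb_orr orbC.
- rewrite big_cat zs big_ord_recr /= -zt; congr addn.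
  rewrite big_seq (eq_bigr (fun => F k)) => [|x]; last by rewrite mt => /andP[_ /eqP->].
  by rewrite -big_seq big_const_seq count_predT iter_addn_0 mulnC.
Qed.

Lemma countsX (T' : eqType) (deg' : T' -> nat) A (B : pred T') h h' :
  counts deg A h -> counts deg' B h' ->
  counts (fun p => deg p.1 + deg' p.2) (fun p => A p.1 && B p.2) (convn h h').
Proof.
move=> HA HB j; have [s [us ms zs]] := counts_prefix j.+1 HA; have [t Ht] := choice HB.
exists [seq (x, y) | x <- s, y <- t (j - deg x)]; split=> [|[x y]|].
- apply: allpairs_uniq_dep => [//|x _|]; first by case: (Ht (j - deg x)).
  by move=> [x y] [x' y'] _ _ /= [-> ->].
- have mt i y' : (y' \in t i) = B y' && (deg' y' == i) by case: (Ht i).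
  apply/allpairsPdep/idP => /= [[x' [y' [xs yt [-> ->]]]]|].
    move: xs yt; rewrite ms mt => /andP[-> xj] /andP[-> /eqP->] /=.
    by rewrite subnKC.
  case/andP => /andP[Ax By] /eqP dxy; exists x, y; rewrite ms mt Ax By -dxy /=.
  by split; rewrite // ?ltnS ?leq_addr // addKn.
- rewrite size_allpairs_dep sumnE big_map /convn -(zs (fun i => h' (j - i))).
  by apply: eq_bigr => x _; case: (Ht (j - deg x)).
Qed.

End Hilb.

Lemma counts_cons (T : eqType) (deg : T -> nat) (A : pred T) (B : pred (seq T)) h h' :
  counts deg A h -> counts (fun w => sumn (map deg w)) B h' ->
  counts (fun w => sumn (map deg w)) (fun w => if w is b :: w' then A b && B w' else false)
    (convn h h').
Proof.
move=> HA HB; apply: (counts_bij (f := fun p => p.1 :: p.2)) (countsX HA HB).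
- by move=> [x y] [x' y'] _ _ /= [-> ->].
- by move=> [x y] /= H; split.
- by case=> // b w /andP[Ab Bw]; exists (b, w); rewrite //= Ab.
Qed.

(** The zero series is a case of its own because [hilbert_pole] requires a positive leading
    coefficient. *)
Definition polar (c : nat) (h : nat -> nat) : Prop :=
  (forall j, h j = 0) \/ exists d e, d <= c /\ hilbert_pole h d e.

Lemma polar_eq c h h' : h =1 h' -> polar c h -> polar c h'.
Proof.
move=> E [H|[d [e [dc H]]]]; first by left=> j; rewrite -E.
by right; exists d, e; split=> //; apply: eq_hilbert_pole H.
Qed.

Lemma polarW c c' h : c <= c' -> polar c h -> polar c' h.
Proof.
move=> cc [H|[d [e [dc H]]]]; first by left.
by right; exists d, e; split=> //; apply: leq_trans cc.
Qed.

Lemma polarD c h h' : polar c h -> polar c h' -> polar c (fun j => h j + h' j).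
Proof.
move=> [H|[d [e [dc H]]]].
  by apply: polar_eq => j; rewrite H.
move=> [H'|[d' [e' [dc' H']]]].
  by right; exists d, e; split=> //; apply: eq_hilbert_pole H => j; rewrite H' addn0.
right; case: (ltngtP d d') => dd.
- by exists d', e'; split=> //; apply: hilbert_poleD_lt dd H H'.
- exists d, e; split=> //; apply: eq_hilbert_pole (hilbert_poleD_lt dd H' H) => j.
  by rewrite addnC.
- by subst d'; exists d, (e + e'); split=> //; apply: hilbert_poleD.
Qed.

Lemma convn0l h h' : (forall j, h j = 0) -> forall j, convn h h' j = 0.
Proof. by move=> H j; rewrite /convn big1 // => i _; rewrite H. Qed.

Lemma convn0r h h' : (forall j, h' j = 0) -> forall j, convn h h' j = 0.
Proof. by move=> H j; rewrite /convn big1 // => i _; rewrite H muln0. Qed.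

Lemma polarM c c' h h' : polar c h -> polar c' h' -> polar (c + c') (convn h h').
Proof.
move=> [H|[d [e [dc H]]]]; first by left; apply: convn0l.
move=> [H'|[d' [e' [dc' H']]]]; first by left; apply: convn0r.
by right; exists (d + d'), (e * e'); split; [apply: leq_add|apply: hilbert_poleM].
Qed.

Lemma counts_point (i : nat) : counts id (pred1 i) (fun j => (j == i) : nat).
Proof.
move=> j; case: eqP => [->|ji]; [exists [:: i]|exists [::]]; split=> // x.
  by rewrite inE /= andbb.
by rewrite /= ; case: eqP => // ->; apply/esym/eqP => E; apply: ji.
Qed.

Lemma counts_ray (e : nat) : counts id (leq e) (convn (fun j => (j == e) : nat) (fun _ => 1)).
Proof.
move=> j; exists (if e <= j then [:: j] else [::]); split=> [|x|].
- by case: ifP.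
- by case: ifP => ej /=; rewrite ?inE; case: eqP => [->|]; rewrite ?andbF ?ej.
rewrite /convn; case: leqP => ej /=.
  rewrite (bigD1 (Ordinal (ej : e < j.+1))) //= eqxx big1 // => i /negbTE ie.
  by rewrite -val_eqE /= in ie; rewrite ie.
by rewrite big1 // => i _; rewrite muln1; case: eqP => // ie; move: (ltn_ord i); rewrite ltnS ie leqNgt ej.
Qed.

(* A set of monomials whose membership only depends on the exponents truncated
   at [e] is a finite disjoint union of products of points and rays. *)
Lemma counts_truncated (c e : nat) (phi : pred (seq nat)) :
  (forall b, size b = c -> phi (map (minn e) b) = phi b) ->
  exists h, counts sumn (fun b => (size b == c) && phi b) h /\ polar c h.
Proof.
elim: c phi => [|c IH] phi Hphi.
  case E : (phi [::]).
    exists (fun j => (j == 0) : nat); split.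
      move=> j; case: eqP => [->|j0]; [exists [:: [::]]|exists [::]]; split=> //.
        by case=> //=; rewrite E.
      by case=> //=; rewrite E /=; case: eqP => // jj; case: j0.
    by right; exists 0, 1; split=> //; apply: hilbert_pole_delta.
  exists (fun _ => 0); split; last by left.
  by apply: counts_ext (counts0 _); case=> //=; rewrite E.
have minnI k : minn e (minn e k) = minn e k by rewrite minnA minnn.
(* When all first coordinates in [P] have the same truncation, membership depends on the remaining
   coordinates only, through [psi]. *)
have piece (P : pred nat) hP i : counts id P hP -> polar 1 hP ->
    (forall k, P k -> minn e k = minn e i) ->
    exists h, counts sumn (fun b => if b is k :: b' then P k && ((size b' == c) && phi b) else false) h
      /\ polar c.+1 h.
  move=> HP pP Pi; pose psi b' := phi (i :: b').
  have psiE k b : P k -> size b = c -> phi (k :: b) = psi b.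
    move=> Pk sb; rewrite /psi -(Hphi (k :: b)) /= ?sb // (Pi _ Pk).
    by rewrite -(Hphi (i :: b)) /= ?sb.
  have [|h [Hh ph]] := IH psi.
    move=> b sb; rewrite /psi -Hphi /= ?size_map ?sb // -[RHS]Hphi /= ?sb //.
    by rewrite -map_comp; congr (phi (_ :: _)); apply: eq_map => x /=.
  exists (convn hP h); split; last exact: (polarM pP ph).
  have H := countsX HP Hh.
  apply: (counts_bij (f := fun p => p.1 :: p.2)) H => //=.
  - by move=> [x y] [x' y'] _ _ /= [-> ->].
  - move=> [k b] /= /and3P[Pk /eqP sb pb]; rewrite Pk sb eqxx /=; split => //.
    by rewrite psiE.
  - case=> // k b /and3P[Pk /eqP sb pb]; exists (k, b) => //=; rewrite Pk sb eqxx /=.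
    by rewrite -(psiE k).
(* First coordinates below [e] are treated as points, with a pole of order 0; those from [e] on form
   a single ray, with a simple pole. *)
have low m : m <= e -> exists h,
    counts sumn (fun b => if b is k :: b' then (k < m) && ((size b' == c) && phi b) else false) h
      /\ polar c.+1 h.
  elim: m => [_|m IHm me].
    by exists (fun _ => 0); split; [apply: counts_ext (counts0 _); case|left].
  have [h1 [H1 p1]] := IHm (ltnW me).
  have [|k /eqP->//|h2 [H2 p2]] := piece (pred1 m) _ m (counts_point m).
    by right; exists 0, 1; split=> //; apply: hilbert_pole_delta.
  exists (fun j => h1 j + h2 j); split; last exact: polarD.
  apply: counts_ext (countsU _ H1 H2); case=> //= k b.
    by rewrite ltnS [k <= m]leq_eqVlt -andb_orl orbC.
  by case/and3P => km _ _; case: eqP km => //= ->; rewrite ltnn.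
have [h1 [H1 p1]] := low e (leqnn e).
have [|k ek|h2 [H2 p2]] := piece (leq e) _ e (counts_ray e).
- right; exists 1, 1; split=> //.
  exact: (hilbert_poleM (hilbert_pole_delta e) hilbert_pole_one).
- by rewrite minnn; apply/minn_idPl.
exists (fun j => h1 j + h2 j); split; last exact: polarD.
apply: counts_ext (countsU _ H1 H2); case=> //= k b.
  by rewrite eqSS -andb_orl; case: ltnP.
by case/and3P => km _ _; rewrite leqNgt km.
Qed.

(** * Linear recurrences on poles *)

Local Open Scope ring_scope.

(* The triple ((a, k), M) stands for the function n |-> a * C(n, k) * (M + 1)^n. *)
Definition expoly_term (t : rat * nat * nat) (n : nat) : rat :=
  t.1.1 * 'C(n, t.1.2)%:R * t.2.+1%:R ^+ n.

Definition expoly (E : nat -> rat) : Prop :=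
  exists l, forall n, E n = \sum_(t <- l) expoly_term t n.

Lemma expoly0 : expoly (fun _ => 0).
Proof. by exists [::] => n; rewrite big_nil. Qed.

Lemma expolyD E E' : expoly E -> expoly E' -> expoly (fun n => E n + E' n).
Proof. by move=> [l H] [l' H']; exists (l ++ l') => n; rewrite big_cat H H'. Qed.

Lemma expolyZ b E : expoly E -> expoly (fun n => b * E n).
Proof.
move=> [l H]; exists [seq (b * t.1.1, t.1.2, t.2) | t <- l] => n.
rewrite H big_map mulr_sumr; apply: eq_bigr => t _.
by rewrite /expoly_term /= !mulrA.
Qed.

Lemma expoly_single a k M : expoly (expoly_term (a, k, M)).
Proof. by exists [:: (a, k, M)] => n; rewrite big_seq1. Qed.

(** In the resonant case [M.+1 = m] the degree in n rises by one, by Pascal's rule. Otherwise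
    Pascal's rule leaves an extra term with C(n, k), which the solution for [k] cancels. *)
Lemma expoly_rec_binomial (m k M : nat) : exists P, expoly P /\
  forall n, P n.+1 = m%:R * P n + 'C(n, k)%:R * M.+1%:R ^+ n.
Proof.
have M0 : M.+1%:R != 0 :> rat by rewrite pnatr_eq0.
case: (eqVneq M.+1 m) => [<-|neq].
  exists (expoly_term (M.+1%:R^-1, k.+1, M)); split; first exact: expoly_single.
  move=> n; rewrite /expoly_term /= binS natrD exprS; field.
  by rewrite -[X in X == 0](natrD _ 1 M) add1n.
have D0 : M.+1%:R - m%:R != 0 :> rat by rewrite subr_eq0 eqr_nat.
elim: k => [|k [P [eP HP]]].
  exists (expoly_term ((M.+1%:R - m%:R)^-1, 0%N, M)); split; first exact: expoly_single.
  move=> n; rewrite /expoly_term /= !bin0 exprS !mulr1 mul1r.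
  move: (M.+1%:R ^+ n) => X; move: (M.+1%:R) D0 => y D0; field.
  exact: D0.
pose D : rat := (M.+1%:R - m%:R)^-1.
exists (fun n => expoly_term (D, k.+1, M) n + (- (D * M.+1%:R)) * P n); split.
  by apply: expolyD; [exact: expoly_single | exact: expolyZ].
move=> n; rewrite HP /expoly_term /= binS natrD exprS /D.
move: (M.+1%:R ^+ n) => X; move: (M.+1%:R) D0 => y D0; field.
exact: D0.
Qed.

Lemma expoly_rec (m : nat) E : expoly E -> exists P, expoly P /\
  forall n, P n.+1 = m%:R * P n + E n.
Proof.
move=> [l]; elim: l E => [|[[a k] M] l IH] E HE.
  exists (fun _ => 0); split=> [|n]; first exact: expoly0.
  by rewrite HE big_nil mulr0 addr0.
have [P [eP HP]] := IH _ (fun n => erefl).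
have [Q [eQ HQ]] := expoly_rec_binomial m k M.
exists (fun n => P n + a * Q n); split; first by apply: expolyD eP _; apply: expolyZ.
by move=> n; rewrite HP HQ HE big_cons /expoly_term /=; ring.
Qed.

Lemma expoly_solve (m : nat) E (e : nat -> rat) n0 : expoly E ->
  (forall n, (n0 <= n)%N -> e n.+1 = m%:R * e n + E n) ->
  exists E', expoly E' /\ forall n, (n0 < n)%N -> e n = E' n.
Proof.
move=> eE He; have [P [eP HP]] := expoly_rec m eE.
pose c := e n0 - P n0.
have Hc k : e (n0 + k)%N = P (n0 + k)%N + c * m%:R ^+ k.
  elim: k => [|k IH]; first by rewrite addn0 expr0 mulr1 /c addrC subrK.
  rewrite addnS He ?leq_addr // IH HP exprS; ring.
(* For [m = 0] the homogeneous part is 0^(n - n0), which is 1 at [n0] and 0 afterwards; this is why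
   the conclusion starts strictly after [n0]. *)
case: m He HP Hc => [|m] He HP Hc.
  exists P; split=> // n nn; rewrite -(subnKC (ltnW nn)) Hc expr0n.
  by rewrite subn_eq0 leqNgt nn mulr0 addr0.
exists (fun n => P n + expoly_term (c / m.+1%:R ^+ n0, 0%N, m) n); split.
  by apply: expolyD eP _; apply: expoly_single.
move=> n nn; rewrite -(subnKC (ltnW nn)) Hc /expoly_term /= bin0 mulr1 exprD.
by rewrite mulrA divfK // expf_neq0 // pnatr_eq0.
Qed.

(** The bound [c'] may depend on [n], as pole orders grow with it; what [c] bounds is the slope [A].
    The first clause also controls the finitely many [n] that the second ignores. *)
Definition good (c : nat) (h : nat -> nat -> nat) : Prop :=
  (forall n, exists c', polar c' (h n)) /\
  ((exists n0, forall n, (n0 <= n)%N -> forall j, h n j = 0%N) \/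
   exists (A : nat) (B : int) (E : nat -> rat) (n0 : nat), [/\ (A <= c)%N, expoly E &
     forall n, (n0 <= n)%N -> exists d e : nat,
       [/\ hilbert_pole (h n) d e, d%:Z = A%:Z * n%:Z + B & e%:R = E n]]).

Lemma good0 c : good c (fun _ _ => 0%N).
Proof. by split=> [n|]; [exists 0%N; left|left; exists 0%N]. Qed.

Lemma polar_add_ex h h' : (exists c, polar c h) -> (exists c, polar c h') ->
  exists c, polar c (fun j => h j + h' j)%N.
Proof.
move=> [c H] [c' H']; exists (maxn c c').
by apply: polarD; [apply: polarW H|apply: polarW H']; rewrite (leq_maxl, leq_maxr).
Qed.

Lemma goodD c h h' : good c h -> good c h' -> good c (fun n j => h n j + h' n j)%N.
Proof.
move=> [p H] [p' H']; split=> [n|]; first exact: polar_add_ex.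
case: H H' => [[n0 H]|[A [B [E [n0 [Ac eE H]]]]]] [[n0' H']|[A' [B' [E' [n0' [Ac' eE' H']]]]]].
- left; exists (maxn n0 n0') => n; rewrite geq_max => /andP[? ?] j.
  by rewrite H // H'.
- right; exists A', B', E', (maxn n0 n0'); split=> // n; rewrite geq_max => /andP[n1 n2].
  have [d [e [h1 h2 h3]]] := H' n n2; exists d, e; split=> //.
  by apply: eq_hilbert_pole h1 => j; rewrite H.
- right; exists A, B, E, (maxn n0 n0'); split=> // n; rewrite geq_max => /andP[n1 n2].
  have [d [e [h1 h2 h3]]] := H n n1; exists d, e; split=> //.
  by apply: eq_hilbert_pole h1 => j; rewrite H' ?addn0.
right.
(* The lexicographic order on (slope, constant) tells which pole eventually dominates; [goodD] is
   symmetric in the two families. *)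
wlog le_AB : h h' A A' B B' E E' n0 n0' p p' eE eE' Ac Ac' H H' /
    (A < A')%N \/ (A = A') /\ (B <= B').
  move=> W; case: (ltngtP A A') => AA.
  - by apply: (W h h' A A' B B' E E' n0 n0') => //; left.
  - have [A2 [B2 [F [n2 [h1 h2 h3]]]]] := W h' h A' A B' B E' E n0' n0 p' p eE' eE Ac' Ac H' H (or_introl AA).
    exists A2, B2, F, n2; split=> // n /h3[d [e [k1 k2 k3]]]; exists d, e; split=> //.
    by apply: eq_hilbert_pole k1 => j; rewrite addnC.
  case: (lerP B B') => BB.
    by apply: (W h h' A A' B B' E E' n0 n0') => //; right.
  have := W h' h A' A B' B E' E n0' n0 p' p eE' eE Ac' Ac H' H.
  case; first by right; split=> //; apply: ltW.
  move=> A2 [B2 [F [n2 [h1 h2 h3]]]].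
  exists A2, B2, F, n2; split=> // n /h3[d [e [k1 k2 k3]]]; exists d, e; split=> //.
  by apply: eq_hilbert_pole k1 => j; rewrite addnC.
have [[AA BB]|lt] : (A = A' /\ B = B') \/ exists N : nat, forall n : nat, (N <= n)%N ->
    A%:Z * n%:Z + B < A'%:Z * n%:Z + B'.
  case: le_AB => [AA|[AA]]; last first.
    rewrite le_eqVlt => /predU1P[BB|BB]; first by left.
    by right; exists 0%N => n _; rewrite AA; lia.
  (* Slopes that differ gain at least [n], which must exceed the difference of the constants. *)
  right; exists (absz B + absz B' + 1)%N => n nn.
  have : (A.+1 * n <= A' * n)%N by rewrite leq_mul2r AA orbT.
  by rewrite mulSn; lia.
- exists A, B, (fun n => E n + E' n), (maxn n0 n0'); split=> //; first exact: expolyD.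
  move=> n; rewrite geq_max => /andP[/H[d [e [h1 h2 h3]]] /H'[d' [e' [h1' h2' h3']]]].
  exists d, (e + e')%N; split=> //; last by rewrite natrD h3 h3'.
  by apply: hilbert_poleD => //; have -> : d = d' by lia.
case: lt => N lt; exists A', B', E', (maxn N (maxn n0 n0')); split=> // n.
rewrite !geq_max => /and3P[nN /H[d [e [h1 h2 h3]]] /H'[d' [e' [h1' h2' h3']]]].
exists d', e'; split=> //; apply: hilbert_poleD_lt h1 h1'.
by have := lt _ nN; lia.
Qed.

Lemma good_convl c l h : (exists c', polar c' l) -> good c h -> good c (fun n => convn l (h n)).
Proof.
move=> [c' pl] [p H]; split=> [n|].
  by have [c'' q] := p n; exists (c' + c'')%N; apply: polarM.
case: pl => [l0|[a [m [_ pl]]]].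
  by left; exists 0%N => n _ j; rewrite convn0l.
case: H => [[n0 H]|[A [B [E [n0 [Ac eE H]]]]]].
  by left; exists n0 => n nn j; rewrite convn0r // => i; rewrite H.
right; exists A, (B + a%:Z), (fun n => m%:R * E n), n0; split=> //; first exact: expolyZ.
move=> n /H[d [e [h1 h2 h3]]]; exists (a + d)%N, (m * e)%N; split.
- exact: hilbert_poleM.
- by rewrite PoszD h2; ring.
- by rewrite natrM h3.
Qed.

Lemma good_intro c x (A : nat) (B : int) (m : nat) E N (F : nat -> nat * nat) :
  (A <= c)%N -> expoly E -> (forall n, exists c', polar c' (x n)) ->
  (forall n, (N <= n)%N -> hilbert_pole (x n) (F n).1 (F n).2) ->
  (forall n, (N <= n)%N -> (F n).1%:Z = A%:Z * n%:Z + B) ->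
  (forall n, (N <= n)%N -> (F n.+1).2%:R = m%:R * (F n).2%:R + E n) ->
  good c x.
Proof.
move=> Ac eE px HF1 HF2 HF3; split=> //; right.
have [E' [eE' HE']] := expoly_solve (e := fun n => (F n).2%:R) eE HF3.
exists A, B, E', N.+1; split=> // n nn; exists (F n).1, (F n).2; split; last exact: HE'.
- exact: HF1 (ltnW nn).
- exact: HF2 (ltnW nn).
Qed.

(** If [l] has a pole of order [a] with coefficient [m], the order of [x n.+1] is the maximum of [a]
    plus that of [x n] and that of [y n]. Comparing [a] with the slope [A] of [y] decides which one
    wins for large [n]. Only a persistent tie adds coefficients, and then they satisfy a linear
    recurrence with multiplier [m]. *)
Lemma good_rec c l x y : polar c l -> (exists c', polar c' (x 0%N)) -> good c y ->
  (forall n j, x n.+1 j = convn l (x n) j + y n j)%N -> good c x.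
Proof.
move=> pl x0 [py Hy] Hx.
have px n : exists c', polar c' (x n).
  elim: n => [//|n [c' IH]].
  have [||c'' q] := @polar_add_ex (convn l (x n)) (y n); last by exists c''; apply: polar_eq q.
    by exists (c + c')%N; apply: polarM.
  exact: py.
case: pl => [l0|[a [m [ac pl]]]].
  have Hx' n : x n.+1 =1 y n by move=> j; rewrite Hx convn0l.
  case: Hy => [[n0 Hy]|[A [B [E [n0 [Ac eE Hy]]]]]].
    split=> //; left; exists n0.+1; case=> // n nn j; rewrite Hx'; exact: Hy.
  have /choice[F HF] : forall n, exists F : nat * nat, (n0 < n)%N ->
      [/\ hilbert_pole (x n) F.1 F.2, F.1%:Z = A%:Z * n%:Z + (B - A%:Z) & F.2%:R = E n.-1].
    case=> [|n]; first by exists (0%N, 0%N).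
    case: (leqP n0 n) => nn; last by exists (0%N, 0%N); rewrite ltnS leqNgt nn.
    have [d [e [h1 h2 h3]]] := Hy n nn; exists (d, e) => _; split=> //=.
      by apply: eq_hilbert_pole h1 => j; rewrite Hx'.
    by rewrite h2; lia.
  apply: (@good_intro c x A (B - A%:Z) 0 E n0.+1 F) => // n nn; try by have [] := HF n nn.
  by have [_ _ ->] := HF n.+1 (ltnW nn); rewrite mul0r add0r.
case: Hy => [[n0 Hy]|[A [B [E [n0 [Ac eE Hy]]]]]].
  have Hx' n : (n0 <= n)%N -> x n.+1 =1 convn l (x n) by move=> nn j; rewrite Hx Hy // addn0.
  have [c' [z|[d [e [_ pd]]]]] := px n0.
    split=> //; left; exists n0 => n /subnKC <- j; elim: (n - n0)%N j => [|k IH] j.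
      by rewrite addn0.
    by rewrite addnS Hx' ?leq_addr // convn0r.
  apply: (@good_intro c x a (d%:Z - a%:Z * n0%:Z) m _ n0
    (fun n => (d + a * (n - n0), e * m ^ (n - n0))%N) ac expoly0) => // n /subnKC <-; rewrite ?addKn.
  - elim: (n - n0)%N => [|k IH]; first by rewrite addn0 muln0 expn0 muln1 addn0.
    have := hilbert_poleM pl IH; rewrite addnS.
    rewrite /= mulnS expnS addnCA mulnCA; apply: eq_hilbert_pole.
    by move=> j; rewrite Hx' ?leq_addr.
  - by rewrite /= !PoszD PoszM; ring.
  - by rewrite /= -addnS addKn expnS addr0 -natrM mulnCA.
have /choice[Y HY] : forall n, exists Y : nat * nat, (n0 <= n)%N ->
    [/\ hilbert_pole (y n) Y.1 Y.2, Y.1%:Z = A%:Z * n%:Z + B & Y.2%:R = E n].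
  move=> n; case: (leqP n0 n) => nn; last by exists (0%N, 0%N).
  by have [d [e [h1 h2 h3]]] := Hy n nn; exists (d, e).
(* Since [y n0] has a pole, [x n0.+1] has one even if [x n0] vanishes. The pair of order and
   coefficient is followed from there on. *)
have [d1 [e1 p1]] : exists d e, hilbert_pole (x n0.+1) d e.
  have [h1 _ _] := HY n0 (leqnn _); have [c' [z|[d [e [_ pd]]]]] := px n0.
    exists (Y n0).1, (Y n0).2; apply: eq_hilbert_pole h1 => j.
    by rewrite Hx convn0r.
  have := hilbert_poleM pl pd; case: (ltngtP (a + d) (Y n0).1) => ad h2.
  - exists (Y n0).1, (Y n0).2; apply: eq_hilbert_pole (hilbert_poleD_lt ad h2 h1) => j.
    by rewrite Hx.
  - exists (a + d)%N, (m * e)%N; apply: eq_hilbert_pole (hilbert_poleD_lt ad h1 h2) => j.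
    by rewrite Hx addnC.
  - exists (a + d)%N, (m * e + (Y n0).2)%N; rewrite -ad in h1.
    by apply: eq_hilbert_pole (hilbert_poleD h2 h1) => j; rewrite Hx.
pose N := n0.+1.
(* The three branches are: [y] wins, a tie in which the coefficients add up, and the product with
   [l] wins. *)
pose stp n (F : nat * nat) : nat * nat :=
  (if (a + F.1 < (Y n).1)%N then Y n
   else if (a + F.1 == (Y n).1)%N then ((Y n).1, (m * F.2 + (Y n).2)%N) else (a + F.1, m * F.2)%N).
pose G := fix G k := if k is k'.+1 then stp (N + k')%N (G k') else (d1, e1).
have HG k : hilbert_pole (x (N + k)%N) (G k).1 (G k).2.
  elim: k => [|k IH]; first by rewrite addn0.
  have [|h1 _ _] := HY (N + k)%N; first by rewrite (leq_trans (leqnSn n0)) // leq_addr.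
  have h2 := hilbert_poleM pl IH; rewrite addnS /= /stp.
  case: (ltngtP (a + (G k).1)%N (Y (N + k)%N).1) => /= ad.
  - apply: eq_hilbert_pole (hilbert_poleD_lt ad h2 h1) => j; by rewrite Hx.
  - by apply: eq_hilbert_pole (hilbert_poleD_lt ad h1 h2) => j; rewrite Hx addnC.
  - rewrite -ad in h1 *.
    by apply: eq_hilbert_pole (hilbert_poleD h2 h1) => j; rewrite Hx.
have Y1 k : (Y (N + k)%N).1%:Z = A%:Z * (N + k)%N%:Z + B.
  by have [|] := HY (N + k)%N; rewrite // (leq_trans (leqnSn n0)) // leq_addr.
have Y2 k : (Y (N + k)%N).2%:R = E (N + k)%N.
  by have [|] := HY (N + k)%N; rewrite // (leq_trans (leqnSn n0)) // leq_addr.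
pose F n := G (n - N)%N.
have HF n : (N <= n)%N -> hilbert_pole (x n) (F n).1 (F n).2.
  by move=> nn; have := HG (n - N)%N; rewrite subnKC.
have GS k : G k.+1 = stp (N + k)%N (G k) by [].
have geG k : (a + (G k).1 <= (G k.+1).1)%N.
  by rewrite GS /stp; case: ltngtP => /= [/ltnW||->].
have linG k0 : (forall k, (k0 <= k)%N -> (G k.+1).1 = a + (G k).1)%N ->
    forall k, (k0 <= k)%N -> (G k).1%:Z = (G k0).1%:Z + a%:Z * k%:Z - a%:Z * k0%:Z.
  move=> H k /subnKC <-; elim: (k - k0)%N => [|i IH]; first by rewrite addn0; lia.
  by rewrite addnS H ?leq_addr //; lia.
(* If the product wins from some step on, the order has slope [a] and the coefficient is geometric
   of ratio [m]. *)
have fin k0 : (forall k, (k0 <= k)%N -> (Y (N + k)%N).1 < a + (G k).1)%N -> good c x.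
  move=> H; have L := linG k0.
  have H2 k : (k0 <= k)%N -> G k.+1 = (a + (G k).1, m * (G k).2)%N.
    by move=> kk; rewrite GS /stp; have := H k kk; case: ltngtP.
  apply: (@good_intro c x a ((G k0).1%:Z - a%:Z * (N + k0)%N%:Z) m _ (N + k0)%N F ac expoly0) => //.
  - by move=> n nn; apply: HF; apply: leq_trans nn; rewrite leq_addr.
  - move=> n nn; rewrite /F L; [|by move=> k kk; rewrite H2|lia].
    have -> : n%:Z = N%:Z + (n - N)%N%:Z by lia.
    by rewrite PoszD; ring.
  - move=> n nn; rewrite /F subSn ?(leq_trans _ nn) ?leq_addr // H2 /=; last by lia.
    by rewrite natrM addr0.
case: (ltngtP a A) => aA.
(* Case [a < A]. If [y] never won, the order would grow with slope [a] and fall behind that of [y].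
   Once ahead, [y] stays ahead, and [x n.+1] takes over its order and coefficient. *)
- have [k0 Hk0] : exists k0, (a + (G k0).1 < (Y (N + k0)%N).1)%N.
    apply: contrapT => H.
    have H2 k : (G k.+1).1 = (a + (G k).1)%N.
      rewrite GS /stp; case: ltngtP => //= lt.
      by case: H; exists k.
    have L := linG 0%N (fun k _ => H2 k).
    pose k := (d1 + a + absz B)%N.
    case: H; exists k; have := L k (leq0n _); have := Y1 k; rewrite /=.
    have : (a.+1 * (N + k) <= A * (N + k))%N by rewrite leq_mul2r aA orbT.
    by rewrite mulSn /k; nia.
  have Hk k : (k0 <= k)%N -> (a + (G k).1 < (Y (N + k)%N).1)%N.
    move=> /subnKC <-; elim: (k - k0)%N => [|i IH]; first by rewrite addn0.
    rewrite addnS GS /stp IH; have := Y1 (k0 + i)%N; have := Y1 (k0 + i).+1; lia.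
  have Gk k : (k0 <= k)%N -> G k.+1 = Y (N + k)%N by move=> /Hk; rewrite GS /stp => ->.
  have Fk n : (N + k0 <= n)%N -> F n.+1 = Y n.
    move=> nn; rewrite /F subSn ?(leq_trans _ nn) ?leq_addr // Gk; last by lia.
    by rewrite subnKC // (leq_trans _ nn) ?leq_addr.
  apply: (@good_intro c x A (B - A%:Z) 0 E (N + k0).+1 F) => //.
  + by move=> n nn; apply: HF; lia.
  + case=> // n nn; rewrite Fk //.
    have := Y1 (n - N)%N; rewrite subnKC; last by lia.
    by move=> ->; lia.
  + move=> n nn; rewrite Fk ?(ltnW nn) // mul0r add0r.
    by have := Y2 (n - N)%N; rewrite subnKC; last by lia.
(* Case [a > A]. The order is at least [d1 + a * k], hence beyond that of [y] from this index on. *)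
- apply: (fin (d1 + absz B + A * N)%N) => k kk.
  have ge : (d1 + a * k <= (G k).1)%N.
    elim: k {kk} => [|k IH]; first by rewrite muln0 addn0.
    by apply: leq_trans (geG k); rewrite mulnS addnCA leq_add2l.
  have := Y1 k; have : (A.+1 * k <= a * k)%N by rewrite leq_mul2r aA orbT.
  by rewrite mulSn; nia.
(* Equal slopes. Either the product wins at every step, or from some step on the two orders are tied
   forever. *)
case: (EM (exists k0, (a + (G k0).1 <= (Y (N + k0)%N).1)%N)) => [[k0 Hk0]|H]; last first.
  by apply: (fin 0%N) => k _; rewrite ltnNge; apply/negP => H'; apply: H; exists k.
have G1 k : (k0 <= k)%N -> (G k.+1).1 = (Y (N + k)%N).1.
  move=> /subnKC <-; elim: (k - k0)%N => [|i IH].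
    by rewrite addn0 GS /stp; move: Hk0; case: ltngtP.
  rewrite addnS GS /stp IH; have := Y1 (k0 + i)%N; have := Y1 (k0 + i).+1.
  by case: ltngtP => //=; lia.
have eqG k : (k0 < k)%N -> (a + (G k).1 = (Y (N + k)%N).1)%N.
  by case: k => // k kk; rewrite G1 //; have := Y1 k; have := Y1 k.+1; lia.
have G2 k : (k0 < k)%N -> (G k.+1).2 = (m * (G k).2 + (Y (N + k)%N).2)%N.
  by move=> /eqG e; rewrite GS /stp e ltnn eqxx.
apply: (@good_intro c x A (B - A%:Z) m E (N + k0).+1 F) => //.
- by move=> n nn; apply: HF; lia.
- move=> n nn; have := eqG (n - N)%N; have := Y1 (n - N)%N; rewrite /F subnKC; last by lia.
  by move=> h1 h2; have := h2 ltac:(lia); lia.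
- move=> n nn; rewrite /F subSn; last by lia.
  rewrite G2; last by lia.
  by rewrite natrD natrM Y2 subnKC; last by lia.
Qed.

Local Close Scope ring_scope.

(** * Words avoiding finitely many words *)

Definition good_family (T : eqType) (deg : T -> nat) (c : nat) (A : nat -> pred T) : Prop :=
  exists h, (forall n, counts deg (A n) (h n)) /\ good c h.

Definition wdeg (w : seq (seq nat)) : nat := sumn (map sumn w).

Definition trunc (e : nat) (b : seq nat) : seq nat := map (minn e) b.

(** Transitions depend on truncated letters only, so this makes the set of successors of a state
    finite. *)
Lemma trunc_box c e : exists s : seq (seq nat), forall b, size b = c -> trunc e b \in s.
Proof.
elim: c => [|c [s Hs]]; first by exists [:: [::]] => b /size0nil->.
exists [seq x :: b | x <- iota 0 e.+1, b <- s] => [[|x b]] // [sb].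
apply/allpairsPdep; exists (minn e x), (trunc e b); split=> //; last exact: Hs.
by rewrite mem_iota ltnS geq_minl.
Qed.

Section Avoid.
Variables (c e : nat).
Implicit Types (S : seq (seq (seq nat))) (w : seq (seq nat)).

(** Words are sorted by the state [T] reached after the first letter. The letters leading to [T]
    form a set invariant under truncation, whose series is polar by [counts_truncated]. *)
Lemma good_family_cons (X : eqType) (st : seq nat -> X) (A : X -> nat -> pred (seq (seq nat))) (Ts : seq X) :
  (forall b, size b = c -> st (trunc e b) = st b) ->
  uniq Ts -> (forall T, T \in Ts -> good_family wdeg c (A T)) ->
  good_family wdeg c (fun n w => if w is b :: w' then [&& size b == c, st b \in Ts & A (st b) n w'] else false).
Proof.
move=> tr; elim: Ts => [|T Ts IH] /=.
  move=> _ _; exists (fun _ _ => 0%N); split=> [n|]; last exact: good0.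
  by apply: counts_ext (counts0 _); case=> //= b w; rewrite andbF.
case/andP=> TTs uTs HTs; have [|h1 [H1 g1]] := IH uTs.
  by move=> T' T'Ts; apply: HTs; rewrite in_cons T'Ts orbT.
have [h2 [H2 g2]] := HTs T (mem_head _ _).
have [|l [Hl pl]] := @counts_truncated c e (fun b => st b == T).
  by move=> b sb; rewrite -/(trunc e b) tr.
exists (fun n j => convn l (h2 n) j + h1 n j)%N; split; last first.
  by apply: goodD => //; apply: good_convl => //; exists c.
move=> n; apply: counts_ext (countsU _ (counts_cons Hl (H2 n)) (H1 n)).
  case=> //= b w; rewrite in_cons; case: (size b == c) => //=.
  by case: eqP => [->|] //=; rewrite (negbTE TTs) orbF.
case=> //= b w /andP[/andP[/eqP-> /eqP->] _].
by rewrite (negbTE TTs) /= andbF.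
Qed.

Definition avoid (k : nat) S (n : nat) : pred (seq (seq nat)) :=
  fun w => [&& size w == n, all (fun b => size b == c) w & ~~ has (fun g => emb lew k g w) S].

Definition bounded S : Prop := forall g a x, g \in S -> a \in g -> x \in a -> x <= e.

(** What remains to be matched after reading [b]. A completed pattern stays as [[::]], which embeds
    in every word, so that no continuation avoids it. *)
Definition step1 (b : seq nat) (g : seq (seq nat)) : seq (seq nat) :=
  if g is a :: g' then if lew a b then g' else g else [::].

Definition step b S := map (step1 b) S.

Definition rcond (b : seq nat) (g : seq (seq nat)) : bool := if g is a :: _ then lew a b else true.

(** In a fixed position, a pattern whose first letter is not below [b] can no longer embed and is
    dropped; a completed pattern is kept. *)
Definition rstep b S := [seq behead g | g <- S & rcond b g].

Lemma emb_step b g w : emb lew 0 g (b :: w) = emb lew 0 (step1 b g) w.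
Proof. by case: g => [|a g] //=; [rewrite emb0s|case: ifP]. Qed.

Lemma emb_rstep k b g w : emb lew k.+1 g (b :: w) = rcond b g && emb lew k (behead g) w.
Proof. by case: g => [|a g] //=; rewrite emb0s. Qed.

Lemma has_rstep k b w S :
  has (fun g => emb lew k.+1 g (b :: w)) S = has (fun g => emb lew k g w) (rstep b S).
Proof.
elim: S => // g S IH.
rewrite -[LHS]/(emb lew k.+1 g (b :: w) || has (fun g => emb lew k.+1 g (b :: w)) S).
by rewrite IH emb_rstep /rstep /=; case: (rcond b g).
Qed.

Lemma lew_trunc a b : (forall x, x \in a -> x <= e) -> lew a (trunc e b) = lew a b.
Proof.
elim: a b => [|x a IH] [|y b] //= H; rewrite /lew /= -/(lew a b) -/(lew a (trunc e b)) IH.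
  by rewrite leq_min H ?mem_head.
by move=> z za; apply: H; rewrite in_cons za orbT.
Qed.

Lemma step_trunc b S : bounded S -> step (trunc e b) S = step b S.
Proof.
move=> bS; apply/eq_in_map => -[|a g] gS //=; rewrite lew_trunc // => x.
by apply: bS gS (mem_head _ _).
Qed.

Lemma rstep_trunc b S : bounded S -> rstep (trunc e b) S = rstep b S.
Proof.
move=> bS; congr map; apply: eq_in_filter => -[|a g] gS //=; rewrite lew_trunc // => x.
by apply: bS gS (mem_head _ _).
Qed.

Lemma bounded_step b S : bounded S -> bounded (step b S).
Proof.
move=> bS _ a x /mapP[g gS ->] ag; suff : a \in g by apply: bS gS.
by case: g ag {gS} => [|a' g] //=; case: ifP => // _; rewrite in_cons => ->; rewrite orbT.
Qed.

Lemma bounded_rstep b S : bounded S -> bounded (rstep b S).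
Proof.
move=> bS g0 a x /mapP[g]; rewrite mem_filter => /andP[_ gS] E; rewrite E => /mem_behead ag.
exact: bS gS ag.
Qed.

Definition weight S := sumn (map size S).

(** Each pattern stays as it is or loses its first letter. Hence a state that has been left is never
    reached again. *)
Lemma step_weight b S : step b S = S \/ weight (step b S) < weight S.
Proof.
suff : weight (step b S) <= weight S /\ (weight (step b S) = weight S -> step b S = S).
  by case; rewrite leq_eqVlt => /predU1P[E H|]; [left; apply: H|right].
elim: S => [|g S [le eq]] //=; rewrite /weight /= -/(weight S) -/(weight (step b S)).
have [le1 eq1] : size (step1 b g) <= size g /\ (size (step1 b g) = size g -> step1 b g = g).
  by case: g => [|a g] //=; case: ifP => //= _; split=> //; lia.
split=> [|E]; first exact: leq_add.
have E1 : size (step1 b g) = size g by lia.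
have E2 : weight (step b S) = weight S by lia.
by rewrite (eq1 E1) (eq E2).
Qed.

Lemma counts_nil (A : pred (seq (seq nat))) : (forall w, A w -> w = [::]) ->
  exists h, counts wdeg A h /\ exists c', polar c' h.
Proof.
move=> HA; case E : (A [::]).
  exists (fun j => (j == 0) : nat); split.
    move=> j; case: eqP => [->|j0]; [exists [:: [::]]|exists [::]]; split=> // w.
      rewrite inE; apply/eqP/andP => [->|[/HA]//]; by rewrite E.
    apply/esym/andP => -[/HA->] /eqP; rewrite /wdeg /=; exact/nesym.
  by exists 0%N; right; exists 0%N, 1%N; split=> //; apply: hilbert_pole_delta.
exists (fun _ => 0%N); split; last by exists 0%N; left.
apply: counts_ext (counts0 _) => w; apply/esym/negP => Aw.
by move: E; rewrite -(HA _ Aw) Aw.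
Qed.

Lemma avoid_nil k S w : avoid k S 0 w -> w = [::].
Proof. by case/and3P => /eqP/size0nil. Qed.

(* Induction on the weight of [S]: by [step_weight], the letters that do not
   decrease it are loops, which gives the recurrence of [good_rec]. *)
Lemma good_avoid0 S : bounded S -> good_family wdeg c (avoid 0 S).
Proof.
have [m] := ubnP (weight S); elim: m S => // m IH S Sm bS.
have [s Hs] := trunc_box c e.
(* Filtering by weight makes the induction hypothesis apply to [Ts]; by [step_weight] no successor
   other than [S] is lost. *)
pose Ts := [seq T <- undup [seq step b S | b <- s] | T != S & weight T < weight S].
have [|||y [Hy gy]] := @good_family_cons _ (step^~ S) (avoid 0) Ts.
- by move=> b _; apply: step_trunc.
- by rewrite filter_uniq // undup_uniq.
- move=> T; rewrite mem_filter mem_undup => /andP[/andP[_ TS] /mapP[b _ ET]].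
  by apply: IH; [apply: leq_trans TS _|rewrite ET; apply: bounded_step].
have [|l [Hl pl]] := @counts_truncated c e (fun b => step b S == S).
  by move=> b _; rewrite -/(trunc e b) step_trunc.
have [h0 [H0 p0]] := counts_nil (@avoid_nil 0 S).
pose h := fix h n := if n is n'.+1 then fun j => (convn l (h n') j + y n' j)%N else h0.
exists h; split; last by apply: (good_rec pl _ gy).
elim=> [|n IHn] //=; apply: counts_ext (countsU _ (counts_cons Hl IHn) (Hy n)).
  case=> [|b w] //=; rewrite /avoid /= eqSS.
  case: eqP => //= sb; rewrite ?andbF //.
  have -> : has (fun g => emb lew 0 g (b :: w)) S = has (fun g => emb lew 0 g w) (step b S).
    by rewrite has_map; apply: eq_has => g; rewrite emb_step.
  case: eqP => [->|/eqP ne] /=; first by rewrite mem_filter eqxx /= orbF.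
  rewrite mem_filter ne mem_undup /=.
  have -> : weight (step b S) < weight S by case: (step_weight b S) => // E; rewrite E eqxx in ne.
  suff -> : step b S \in [seq step b' S | b' <- s] by [].
  by apply/mapP; exists (trunc e b); rewrite ?step_trunc ?Hs.
case=> //= b w /andP[/andP[/eqP-> /eqP ->] _].
by rewrite eqxx mem_filter eqxx.
Qed.

Lemma good_avoid k S : bounded S -> good_family wdeg c (avoid k S).
Proof.
elim: k S => [|k IH] S bS; first exact: good_avoid0.
have [s Hs] := trunc_box c e.
pose Ts := undup [seq rstep b S | b <- s].
have [|||y [Hy gy]] := @good_family_cons _ (rstep^~ S) (avoid k) Ts.
- by move=> b _; apply: rstep_trunc.
- by rewrite undup_uniq.
- by move=> T; rewrite mem_undup => /mapP[b _ ->]; apply: IH; apply: bounded_rstep.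
have [h0 [H0 p0]] := counts_nil (@avoid_nil k.+1 S).
pose h n := if n is n'.+1 then y n' else h0.
exists h; split; last first.
  (* A letter in a fixed position is read only once, so there is no loop and the recurrence has
     [l = 0]. *)
  apply: (@good_rec c (fun _ => 0%N) h y _ _ gy) => //; first by left.
  by move=> n j; rewrite convn0l.
case=> [|n] //=; apply: counts_ext (Hy n).
case=> [//|b w]; rewrite /avoid has_rstep /= eqSS; case: eqP => //= sb; rewrite ?andbF //.
suff -> : rstep b S \in Ts by [].
by rewrite mem_undup; apply/mapP; exists (trunc e b); rewrite ?rstep_trunc ?Hs.
Qed.

End Avoid.

(** * Limits of exponential polynomials *)

Local Open Scope ring_scope.

Section Limits.
Local Open Scope classical_set_scope.
Variable R : realType.
Implicit Types (r : R).

(** With [s] the square root of [r], one factor [n * s ^ n] is split off at each step of the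
    induction on [k]. *)
Lemma poly_geometric_bounded k r : 0 <= r < 1 ->
  exists C : R, forall n : nat, n%:R ^+ k * r ^+ n <= C.
Proof.
elim: k r => [|k IH] r /andP[r0 r1].
  by exists 1 => n; rewrite expr0 mul1r exprn_ile1 // ltW.
pose s := Num.sqrt r.
have s0 : 0 <= s by apply: sqrtr_ge0.
have ss : s ^+ 2 = r by rewrite sqr_sqrtr.
have s1 : s < 1 by rewrite -sqrtr1 ltr_sqrt.
have [|C HC] := IH s; first by rewrite s0.
exists (Num.max 0 C * (1 - s)^-1) => n.
have -> : n%:R ^+ k.+1 * r ^+ n = (n%:R ^+ k * s ^+ n) * (n%:R * s ^+ n).
  by rewrite -ss -exprM mul2n -addnn exprD exprS; ring.
apply: ler_pM; rewrite ?mulr_ge0 ?exprn_ge0 ?ler0n //.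
  by rewrite le_max HC orbT.
rewrite -[_^-1]mul1r ler_pdivlMr ?subr_gt0 //.
apply: (@le_trans _ _ (1 - s ^+ n)); last by rewrite gerBl exprn_ge0.
(* This is n s^n <= 1 + s + ... + s^(n-1), multiplied by 1 - s. *)
elim: n => [|n IHn]; first by rewrite !mul0r expr0 subrr.
have sn : s ^+ n.+1 <= 1 by rewrite exprn_ile1 // ltW.
have h : s * (n%:R * s ^+ n * (1 - s)) <= s * (1 - s ^+ n) by apply: ler_wpM2l.
rewrite -natr1 mulrDl mulrDl mul1r exprS.
rewrite exprS in sn.
have h2 : 0 <= (1 - s) * (1 - s * s ^+ n) by rewrite mulr_ge0 // subr_ge0 // ltW.
move: (s ^+ n) h h2 sn => x h h2 sn; nra.
Qed.

Lemma cvg_poly_geometric k r : 0 <= r < 1 -> (fun n : nat => n%:R ^+ k * r ^+ n) @ \oo --> (0 : R).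
Proof.
move=> /andP[r0 r1]; pose s := Num.sqrt r.
have s0 : 0 <= s by apply: sqrtr_ge0.
have ss : s ^+ 2 = r by rewrite sqr_sqrtr.
have s1 : s < 1 by rewrite -sqrtr1 ltr_sqrt.
have [|C HC] := @poly_geometric_bounded k s; first by rewrite s0.
have sc : (fun n : nat => C * s ^+ n) @ \oo --> (0 : R).
  rewrite -(mulr0 C); apply: cvgMr; apply: cvg_expr; rewrite ger0_norm //.
apply: (squeeze_cvgr _ (cvg_cst 0) sc); near=> n.
rewrite mulr_ge0 ?exprn_ge0 //=.
have -> : n%:R ^+ k * r ^+ n = (n%:R ^+ k * s ^+ n) * s ^+ n.
  by rewrite -ss -exprM mul2n -addnn exprD; ring.
by apply: ler_wpM2r => //; apply: exprn_ge0.
Unshelve. all: by end_near.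
Qed.

Lemma cvg_invn : (fun n : nat => (n%:R : R)^-1) @ \oo --> (0 : R).
Proof.
rewrite -cvg_shiftS; exact: (@cvg_harmonic R).
Qed.

Lemma cvg_binomial k : (fun n : nat => 'C(n, k)%:R / n%:R ^+ k) @ \oo --> (k`!%:R^-1 : R).
Proof.
elim: k => [|k IH].
  apply: cvg_near_cst; near=> n; by rewrite bin0 expr0 fact0 divr1 invr1.
have -> : (k.+1`!%:R^-1 : R) = k`!%:R^-1 * ((1 - k%:R * 0) * k.+1%:R^-1).
  by rewrite mulr0 subr0 mul1r factS natrM invfM mulrC.
have H : (fun n : nat => (1 - k%:R * n%:R^-1) * k.+1%:R^-1 : R) @ \oo --> ((1 - k%:R * 0) * k.+1%:R^-1 : R).
  by apply: cvgMl; apply: cvgB; [apply: cvg_cst|apply: cvgMr; apply: cvg_invn].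
apply: cvg_trans (cvgM IH H); apply: near_eq_cvg; near=> n.
have n0 : n%:R != 0 :> R by rewrite pnatr_eq0 -lt0n; near: n; exists 1%N.
have nk : (k <= n)%N by near: n; exists k.
have := mul_bin_left n k; move/(congr1 (fun x => x%:R : R)); rewrite !natrM natrB // => E.
rewrite /= -[X in _ = X / _](mulKf (_ : k.+1%:R != 0 :> R)) ?pnatr_eq0 // E exprS.
rewrite -natr1; field; rewrite n0 /= expf_neq0 //=.
by rewrite natr1 pnatr_eq0.
Unshelve. all: by end_near.
Qed.

Lemma cvg_invXn j : (fun n : nat => (n%:R ^+ j)^-1 : R) @ \oo --> ((j == 0%N)%:R : R).
Proof.
case: j => [|j]; first by apply: cvg_near_cst; near=> n; rewrite expr0 invr1.
elim: j => [|j IH] /=; first by under eq_fun do rewrite expr1; exact: cvg_invn.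
under eq_fun do rewrite exprS invfM.
by have H := cvgM cvg_invn IH; rewrite mulr0 in H; exact: H.
Unshelve. all: by end_near.
Qed.

(** Lexicographic comparison of growth, first by the base and then by the degree in n; the bases are
    [t.2.+1] and [M.+1]. *)
Definition dominated (t : rat * nat * nat) (M L : nat) : bool :=
  (t.2 < M)%N || (t.2 == M) && (t.1.2 <= L)%N.

Lemma cvg_expoly_term t M L : dominated t M L ->
  (fun n : nat => ratr (expoly_term t n) / (M.+1 ^ n * n ^ L)%N%:R) @ \oo -->
    (if (t.2 == M) && (t.1.2 == L) then ratr (t.1.1 / L`!%:R) else 0 : R).
Proof.
case: t => [[a k] m]; rewrite /dominated /expoly_term /=.
have M0 j : j.+1%:R != 0 :> R by rewrite pnatr_eq0.
have split n : (0 < n)%N -> ratr (a * 'C(n, k)%:R * m.+1%:R ^+ n) / (M.+1 ^ n * n ^ L)%N%:R =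
   ratr a * (('C(n, k)%:R / n%:R ^+ k) * (n%:R ^+ k * (m.+1%:R / M.+1%:R) ^+ n * (n%:R ^+ L)^-1)) :> R.
  move=> n0; have n1 : n%:R != 0 :> R by rewrite pnatr_eq0 -lt0n.
  rewrite !rmorphM rmorphXn /= !ratr_nat ?natrM !natrX expr_div_n.
  by field; rewrite !expf_neq0 // n1.
case: (eqVneq m M) split => [->|neq] split /=; last first.
  rewrite orbF => mM.
  have r1 : 0 <= (m.+1%:R / M.+1%:R : R) < 1.
    by rewrite divr_ge0 //= ltr_pdivrMr ?mul1r ?ltr_nat ?ltr0n.
  have H : (fun n : nat => ratr a * (('C(n, k)%:R / n%:R ^+ k) *
      (n%:R ^+ k * (m.+1%:R / M.+1%:R) ^+ n * (n%:R ^+ L)^-1))) @ \oo -->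
      (ratr a * (k`!%:R^-1 * (0 * (L == 0%N)%:R)) : R).
    apply: cvgM; first exact: cvg_cst.
    apply: cvgM; first exact: cvg_binomial.
    by apply: cvgM; [exact: cvg_poly_geometric|exact: cvg_invXn].
  rewrite mul0r !mulr0 in H; apply: cvg_trans H; apply: near_eq_cvg; near=> n.
  by rewrite /= split //; near: n; exists 1%N.
rewrite ltnn /= => kL.
have -> : (if k == L then ratr (a / L`!%:R) else 0 : R) =
    ratr a * (k`!%:R^-1 * ((L - k)%N == 0%N)%:R).
  rewrite subn_eq0; case: (eqVneq k L) => [->|kL'].
    by rewrite leqnn mulr1 fmorph_div; congr (_ / _); rewrite rmorph_nat.
  by rewrite leqNgt ltn_neqAle kL' kL /= !mulr0.
have H : (fun n : nat => ratr a * (('C(n, k)%:R / n%:R ^+ k) * (n%:R ^+ (L - k))^-1)) @ \oo -->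
    (ratr a * (k`!%:R^-1 * ((L - k)%N == 0%N)%:R) : R).
  apply: cvgM; first exact: cvg_cst.
  by apply: cvgM; [exact: cvg_binomial|exact: cvg_invXn].
apply: cvg_trans H; apply: near_eq_cvg; near=> n.
have n0 : (0 < n)%N by near: n; exists 1%N.
have n1 : n%:R != 0 :> R by rewrite pnatr_eq0 -lt0n.
rewrite /= split // divff // expr1n mulr1 -{2}(subnKC kL) exprD.
by congr (_ * (_ * _)); rewrite invfM mulrA mulfV ?mul1r // expf_neq0.
Unshelve. all: by end_near.
Qed.

(** The terms of largest growth (M, L) determine the limit, provided that their coefficients do not
    sum to zero. The factor L! comes from C(n, L) ~ n^L / L!. *)
Lemma expoly_cvg E : expoly E -> E =1 (fun _ => 0) \/
  exists (M L : nat) (q : rat), q != 0 /\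
    (fun n : nat => ratr (E n) / (M ^ n * n ^ L)%N%:R) @ \oo --> (ratr q : R).
Proof.
move=> [l]; have [s] := ubnP (size l); elim: s l E => // s IH l E ls HE.
case: (eqVneq l [::]) => [l0|lne].
  by left => n; rewrite HE l0 big_nil.
have [M [L [domL [t0 t0l /andP[/eqP t0M /eqP t0L]]]]] : exists M L : nat, (forall t, t \in l -> dominated t M L) /\
    exists2 t, t \in l & (t.2 == M) && (t.1.2 == L).
  elim: l lne {ls HE IH} => // t l IH _.
  case: (eqVneq l [::]) => [->|/IH[M [L [H [t' t'l /andP[/eqP tM /eqP tL]]]]]].
    exists t.2, t.1.2; split; last by exists t; rewrite ?mem_head ?eqxx.
    by move=> t'; rewrite inE => /eqP->; rewrite /dominated eqxx leqnn orbT.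
  case D : (dominated t M L).
    exists M, L; split; last by exists t'; rewrite ?in_cons ?t'l ?orbT ?tM ?tL ?eqxx.
    by move=> u; rewrite in_cons => /predU1P[->|/H].
  exists t.2, t.1.2; split; last by exists t; rewrite ?mem_head ?eqxx.
  move=> u; rewrite in_cons => /predU1P[->|/H]; first by rewrite /dominated eqxx leqnn orbT.
  by move: D; rewrite /dominated; lia.
pose top (t : rat * nat * nat) := (t.2 == M) && (t.1.2 == L).
pose q : rat := \sum_(t <- l | top t) t.1.1 / L`!%:R.
have lim : (fun n : nat => ratr (E n) / (M.+1 ^ n * n ^ L)%N%:R) @ \oo --> (ratr q : R).
  rewrite /q rmorph_sum /= big_mkcond /=.
  have -> : (fun n : nat => ratr (E n) / (M.+1 ^ n * n ^ L)%N%:R : R) =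
     (fun n => \sum_(t <- l) (ratr (expoly_term t n) / (M.+1 ^ n * n ^ L)%N%:R)).
    by apply: funext => n; rewrite HE rmorph_sum mulr_suml.
  elim: l domL {ls HE IH lne q t0l} => [|t l IHl] domL.
    by rewrite big_nil; apply: cvg_near_cst; near=> n; rewrite big_nil.
  rewrite big_cons; under eq_fun do rewrite big_cons.
  apply: cvgD; last by apply: IHl => u ul; apply: domL; rewrite in_cons ul orbT.
  by apply: cvg_expoly_term; apply: domL; rewrite mem_head.
case: (eqVneq q 0) => q0; last by right; exists M.+1, L, q.
(* The top terms are multiples of one and the same function of n, so for [q = 0] they cancel
   identically and can be removed. *)
apply: (IH [seq t <- l | ~~ top t]).
  rewrite -ltnS; apply: leq_trans ls; rewrite ltnS size_filter -(count_predC top l).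
  rewrite -[X in (X < _)%N]add0n ltn_add2r.
  by rewrite -has_count; apply/hasP; exists t0; rewrite // /top t0M t0L !eqxx.
move=> n; rewrite HE big_filter [LHS](bigID top) /=.
rewrite (eq_bigr (fun t => t.1.1 / L`!%:R * (L`!%:R * ('C(n, L)%:R * M.+1%:R ^+ n)))); last first.
  move=> t /andP[/eqP tM /eqP tL]; rewrite /expoly_term tM tL.
  rewrite mulrA divfK ?mulrA // pnatr_eq0 -lt0n fact_gt0 //.
by rewrite -mulr_suml -/q q0 mul0r add0r.
Unshelve. all: by end_near.
Qed.

Lemma expoly_limit E (e : nat -> int) n0 : expoly E ->
  (forall n, (n0 <= n)%N -> 0 < E n /\ (e n)%:~R = E n) ->
  exists (M L : nat) (q : rat), 0 < q /\
    (fun n : nat => (e n)%:~R / (M ^ n * n ^ L)%N%:R : R) @ \oo --> (ratr q : R).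
Proof.
move=> eE He; have [E0|[M [L [q [q0 lim]]]]] := expoly_cvg eE.
  by have [] := He n0 (leqnn _); rewrite E0 ltxx.
exists M, L, q.
have lim' : (fun n : nat => (e n)%:~R / (M ^ n * n ^ L)%N%:R : R) @ \oo --> (ratr q : R).
  apply: cvg_trans lim; apply: near_eq_cvg; near=> n.
  have [|_ En] := He n; first by near: n; exists n0.
  by rewrite -En ratr_int.
split=> //; rewrite lt_def q0 /=.
suff : 0 <= (ratr q : R) by rewrite ler0q.
apply: (cvgr_to_ge lim').
near=> n; have [|En0 En] := He n; first by near: n; exists n0.
by rewrite divr_ge0 // -(ratr_int R) En ler0q ltW.
Unshelve. all: by end_near.
Qed.

End Limits.

(** * Ideals, leading monomials and Krull dimension *)

Section Ideals.
Variables (K : fieldType) (N : nat).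
Local Notation P := {mpoly K[N]}.
Local Notation mon := 'X_{1..N}.
Implicit Types (Q : P -> Prop) (p q r : P) (m : mon).

(** Unlike [idealr], this admits the unit ideal, which may arise when an element is adjoined. *)
Definition ideal_pred Q : Prop :=
  [/\ Q 0, forall p q, Q p -> Q q -> Q (p + q) & forall p q, Q q -> Q (p * q)].

Definition graded_pred Q : Prop := forall j p, Q p -> Q (pihomog mdeg j p).

Lemma idealZ Q : ideal_pred Q -> forall a p, Q p -> Q (a *: p).
Proof. by case=> _ _ H a p Qp; rewrite -mul_mpolyC; apply: H. Qed.

Lemma idealN Q : ideal_pred Q -> forall p, Q p -> Q (- p).
Proof. by case=> _ _ H p Qp; rewrite -mulN1r; apply: H. Qed.

Lemma idealB Q : ideal_pred Q -> forall p q, Q p -> Q q -> Q (p - q).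
Proof. by move=> iQ p q Qp Qq; case: (iQ) => _ H _; apply: H => //; apply: idealN. Qed.

Lemma ideal_sum Q : ideal_pred Q -> forall (I : Type) (s : seq I) (R : pred I) (F : I -> P),
  (forall i, R i -> Q (F i)) -> Q (\sum_(i <- s | R i) F i).
Proof. by case=> Q0 QD _ I s R F HF; apply: (big_ind Q). Qed.

Lemma ideal_subl Q : ideal_pred Q -> forall p q, Q (p - q) -> Q p -> Q q.
Proof. by move=> iQ p q H Qp; have := idealB iQ Qp H; rewrite subKr. Qed.

Lemma ideal_subr Q : ideal_pred Q -> forall p q, Q (p - q) -> Q q -> Q p.
Proof. by move=> iQ p q H Qq; case: (iQ) => _ QD _; have := QD _ _ H Qq; rewrite subrK. Qed.

Lemma mcoeff_pihomog j p m : (pihomog mdeg j p)@_m = if mdeg m == j then p@_m else 0.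
Proof.
elim/mpolyind: p => [|c m' p _ _ IH]; first by rewrite pihomog0 mcoeff0 if_same.
rewrite pihomogD mcoeffD IH linearZ /= pihomogX mcoeffD !mcoeffZ mcoeffX.
case: (eqVneq m' m) => [->|neq].
  by case: ifP => _; rewrite ?mcoeffX ?eqxx ?mcoeff0 ?mulr0 ?addr0.
by case: (mdeg m' == j); rewrite ?mcoeffX ?mcoeff0 ?(negbTE neq) !mulr0 !add0r.
Qed.

Definition lead_in Q m : Prop := exists p, [/\ Q p, p != 0 & mlead p = m].

Definition standard Q : pred mon := fun m => `[< ~ lead_in Q m >].

Lemma mleadMX p m : p != 0 -> mlead (p * 'X_[m]) = (mlead p + m)%MM.
Proof.
move=> p0; rewrite mleadM_proper ?mleadXm // mcoeffX eqxx mulr1.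
by rewrite mleadc_eq0.
Qed.

Lemma lead_in_up Q m m' : ideal_pred Q -> (m <= m')%MM -> lead_in Q m -> lead_in Q m'.
Proof.
case=> _ _ HM mm' [p [Qp p0 Em]]; move: mm'; rewrite -Em => mm'; exists (p * 'X_[m' - mlead p]); split.
- by rewrite mulrC; apply: HM.
- by rewrite mulf_neq0 // -msize_poly_eq0 msizeX.
- by rewrite mleadMX // addmC submK.
Qed.

Lemma standard_indep Q p : ideal_pred Q -> Q p -> (forall m, m \in msupp p -> standard Q m) -> p = 0.
Proof.
move=> iQ Qp Hp; apply/eqP; apply: contraT => p0.
by have /asboolP[] := Hp _ (mlead_supp p0); exists p.
Qed.

Lemma mlead_subZ p q c m : p@_m = c * q@_m -> (mlead p <= m)%O -> (mlead q <= m)%O ->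
  p - c *: q != 0 -> (mlead (p - c *: q) < m)%O.
Proof.
move=> E lp lq nz; rewrite lt_neqAle; apply/andP; split.
  apply: contra_neq nz => Em; apply/eqP; rewrite -mleadc_eq0 Em.
  by rewrite mcoeffB mcoeffZ E subrr.
apply: le_trans (mleadB_le _ _) _; rewrite leUx lp /=.
exact: le_trans (mleadZ_le _ _) lq.
Qed.

(** Division with remainder: the leading term is cancelled by an element of [Q] or moved to the
    remainder. As the monomial order refines the degree, the bound by [mlead p] also bounds the
    degree of the remainder, as [chain_length] requires. *)
Lemma reduce Q : ideal_pred Q -> forall p, exists p',
  Q (p - p') /\ forall m, m \in msupp p' -> standard Q m /\ (m <= mlead p)%O.
Proof.
move=> iQ p; case: (iQ) => Q0 QD QM.
elim/mleadrect: p => p IH.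
case: (eqVneq p 0) => [->|p0].
  by exists 0; rewrite subr0; split=> // m; rewrite msupp0.
have step q c : (p - c *: q = 0) \/ (mlead (p - c *: q) < mlead p)%O ->
   exists p', Q (p - c *: q - p') /\ forall m, m \in msupp p' -> standard Q m /\ (m <= mlead p)%O.
  case=> [->|lt]; first by exists 0; rewrite subr0; split=> // m; rewrite msupp0.
  have [p' [H1 H2]] := IH _ lt; exists p'; split=> // m /H2[sm le]; split=> //.
  exact: le_trans le (ltW lt).
case: (EM (lead_in Q (mlead p))) => [[q [Qq q0 Eq]]|nin].
  have qc : q@_(mlead p) != 0 by rewrite -Eq mleadc_eq0.
  have [|p' [H1 H2]] := step q (p@_(mlead p) / q@_(mlead p)).
    case: (eqVneq (p - (p@_(mlead p) / q@_(mlead p)) *: q) 0) => [|nz]; [by left|right].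
    by apply: mlead_subZ nz; rewrite ?divfK // ?Eq.
  exists p'; split=> //; have := QD _ _ H1 (idealZ iQ (p@_(mlead p) / q@_(mlead p)) Qq).
  by rewrite addrAC subrK.
have [|p' [H1 H2]] := step 'X_[mlead p] p@_(mlead p).
  case: (eqVneq (p - p@_(mlead p) *: 'X_[mlead p]) 0) => [|nz]; [by left|right].
  by apply: mlead_subZ nz; rewrite ?mcoeffX ?eqxx ?mulr1 ?mleadXm.
exists (p@_(mlead p) *: 'X_[mlead p] + p'); split; first by rewrite opprD addrA.
move=> m /msuppD_le; rewrite mem_cat => /orP[/msuppZ_le|/H2//].
by rewrite msuppX inE => /eqP->; split=> //; apply/asboolP.
Qed.

Lemma hreduce Q j p : ideal_pred Q -> graded_pred Q -> p \is j.-homog -> exists p',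
  [/\ Q (p - p'), p' \is j.-homog & forall m, m \in msupp p' -> standard Q m].
Proof.
move=> iQ gQ pj; have [p' [H1 H2]] := reduce iQ p.
exists (pihomog mdeg j p'); split; last 2 first.
- exact: pihomogP.
- move=> m; rewrite mcoeff_msupp mcoeff_pihomog; case: ifP => _; rewrite ?eqxx //.
  by rewrite -mcoeff_msupp => /H2[].
by rewrite -{1}(pihomog_dE pj) -pihomogB; apply: gQ.
Qed.

Lemma standard_exists (A : pred mon) : exists h, counts mdeg A h.
Proof.
suff /choice[s Hs] : forall j, exists s : seq mon, uniq s /\ forall m, (m \in s) = A m && (mdeg m == j).
  by exists (fun j => size (s j)) => j; exists (s j); case: (Hs j).
move=> j; exists [seq m <- map val (enum {: 'X_{1..N < j.+1}}) | A m && (mdeg m == j)].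
split=> [|m]; first by rewrite filter_uniq // map_inj_uniq ?enum_uniq //; apply: val_inj.
rewrite mem_filter andb_idr // => /andP[_ /eqP mj].
have lt : (mdeg m < j.+1)%N by rewrite mj.
by apply/mapP; exists (BMultinom lt); rewrite ?mem_enum.
Qed.

(** With more [x] than [y], the matrix of coefficients has a nonzero vector in its left kernel,
    which is a linear relation modulo [Q]. *)
Lemma indep_le_span Q (J I : finType) (x : J -> P) (y : I -> P) : ideal_pred Q ->
  (forall j, exists A : I -> K, Q (x j - \sum_i A i *: y i)) ->
  (forall a : J -> K, Q (\sum_j a j *: x j) -> forall j, a j = 0) -> (#|J| <= #|I|)%N.
Proof.
move=> iQ /choice[A HA] ind; rewrite leqNgt; apply/negP => lt.
pose M : 'M[K]_(#|J|, #|I|) := \matrix_(i, j) A (enum_val i) (enum_val j).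
have kn0 : kermx M != 0.
  by rewrite kermx_eq0 /row_free neq_ltn (leq_ltn_trans (rank_leq_col _) lt).
have [u uM un0] : exists2 u : 'rV_#|J|, u *m M = 0 & u != 0.
  have /rowV0Pn[u /sub_kermxP uM un0] := kn0; by exists u.
case/negP: un0; apply/eqP/rowP => k; rewrite mxE -[k]enum_valK.
apply: (ind (fun j => u 0 (enum_rank j))).
suff -> : \sum_j u 0 (enum_rank j) *: x j =
    \sum_j u 0 (enum_rank j) *: (x j - \sum_i A j i *: y i).
  by apply: ideal_sum => // j _; apply: idealZ.
apply/eqP; rewrite -subr_eq0 -sumrB.
rewrite (eq_bigr (fun j => \sum_i (u 0 (enum_rank j) * A j i) *: y i)); last first.
  move=> j _; rewrite -scalerBr subKr scaler_sumr.
  by apply: eq_bigr => i _; rewrite scalerA.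
rewrite exchange_big big1 //= => i _; rewrite -scaler_suml.
have := congr1 (fun B : 'rV_#|I| => B 0 (enum_rank i)) uM; rewrite !mxE.
rewrite (reindex (@enum_rank J)) /=; last by apply: onW_bij; apply: enum_rank_bij.
move=> E; suff -> : \sum_j u 0 (enum_rank j) * A j i = 0 by rewrite scale0r.
by rewrite -[RHS]E; apply: eq_bigr => j _; rewrite mxE !enum_rankK.
Qed.

Lemma mpoly_sum_supp p (s : seq mon) : uniq s -> {subset msupp p <= s} ->
  p = \sum_(i < size s) p@_(nth 0%MM s i) *: 'X_[nth 0%MM s i].
Proof.
move=> us sub; rewrite -(big_mkord predT (fun i => p@_(nth 0%MM s i) *: 'X_[nth 0%MM s i])).
rewrite -(big_nth 0%MM predT (fun m => p@_m *: 'X_[m])) {1}[p]mpolyE.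
rewrite [RHS](bigID (mem (msupp p))) /= [X in _ = _ + X]big1 ?addr0; last first.
  by move=> m; rewrite mcoeff_msupp negbK => /eqP->; rewrite scale0r.
rewrite -[RHS]big_filter; apply: perm_big; apply: uniq_perm; rewrite ?msupp_uniq ?filter_uniq //.
by move=> m; rewrite mem_filter andb_idr // => /sub.
Qed.

Lemma pihomogMl a d j r : a \is d.-homog ->
  pihomog mdeg j (a * r) = if (d <= j)%N then a * pihomog mdeg (j - d) r else 0.
Proof.
move=> ad; elim/mpolyind: r => [|c m p _ _ IH]; first by rewrite !(mulr0, pihomog0) if_same.
rewrite mulrDr !pihomogD IH -scalerAr !linearZ /=.
have H : a * 'X_[m] \is (d + mdeg m).-homog by apply: dhomogM; rewrite ?dhomogX.
rewrite pihomogX; case: leqP => dj; last first.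
  by rewrite (pihomog_ne0 _ H) ?scaler0 ?addr0 // gtn_eqF // ltn_addr.
rewrite mulrDr; congr (_ + _); case: eqP => E.
  by rewrite -scalerAr pihomog_dE //; move: H; rewrite E subnKC.
rewrite (pihomog_ne0 _ H) ?scaler0 ?mulr0 //.
by apply/eqP => E'; apply: E; rewrite -E' addKn.
Qed.

Definition adjoin Q a : P -> Prop := fun p => exists q r, Q q /\ p = q + a * r.

Lemma adjoin_ideal Q a : ideal_pred Q -> ideal_pred (adjoin Q a).
Proof.
case=> Q0 QD QM; split=> [|p q|p q].
- by exists 0, 0; rewrite mulr0 addr0.
- move=> [q1 [r1 [h1 ->]]] [q2 [r2 [h2 ->]]]; exists (q1 + q2), (r1 + r2).
  by split; [apply: QD|rewrite mulrDr addrACA].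
- move=> [q1 [r1 [h1 ->]]]; exists (p * q1), (p * r1).
  by split; [apply: QM|rewrite mulrDr mulrCA].
Qed.

Lemma adjoin_graded Q a d : graded_pred Q -> ideal_pred Q -> a \is d.-homog -> graded_pred (adjoin Q a).
Proof.
move=> gQ [Q0 _ _] ad j p [q [r [Qq ->]]]; rewrite pihomogD (pihomogMl _ _ ad).
case: ifP => _; last by exists (pihomog mdeg j q), 0; rewrite mulr0; split=> //; apply: gQ.
by exists (pihomog mdeg j q), (pihomog mdeg (j - d) r); split=> //; apply: gQ.
Qed.

Lemma adjoin_sub Q a p : Q p -> adjoin Q a p.
Proof. by move=> Qp; exists p, 0; rewrite mulr0 addr0. Qed.

Lemma adjoin_gen Q a : ideal_pred Q -> adjoin Q a a.
Proof. by case=> Q0 _ _; exists 0, 1; rewrite mulr1 add0r. Qed.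

(* The exact sequence P/(Q : a) -> P/Q -> P/(Q + a), as an inequality. *)
Lemma counts_adjoin Q Q2 a d h h1 h2 : ideal_pred Q -> graded_pred Q ->
  ideal_pred Q2 -> graded_pred Q2 -> a \is d.-homog -> (forall r, Q2 r -> Q (a * r)) ->
  counts mdeg (standard Q) h -> counts mdeg (standard (adjoin Q a)) h1 -> counts mdeg (standard Q2) h2 ->
  forall j, (h j <= h1 j + (if (d <= j)%N then h2 (j - d)%N else 0))%N.
Proof.
move=> iQ gQ iQ2 gQ2 ad aQ2 H H1 H2 j; case: (iQ) => Q0 QD QM.
have [s [us ms <-]] := H j; have [s1 [us1 ms1 <-]] := H1 j.
have [s2 [us2 ms2 zs2]] : exists s2, [/\ uniq s2,
    forall m, (m \in s2) = [&& (d <= j)%N, standard Q2 m & mdeg m == (j - d)%N] &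
    size s2 = (if (d <= j)%N then h2 (j - d)%N else 0)%N].
  by case: ifP => dj; [exact: H2|exists [::]].
rewrite -zs2.
pose mn (l : seq mon) (i : 'I_(size l)) : P := 'X_[nth 0%MM l i].
suff : (#|{: 'I_(size s)}| <= #|{: 'I_(size s1) + 'I_(size s2)}|)%N.
  by rewrite card_sum !card_ord.
apply: (indep_le_span (x := @mn s)
  (y := fun i : 'I_(size s1) + 'I_(size s2) => match i with inl i => mn s1 i | inr i => a * mn s2 i end) iQ).
  move=> i; set p := mn s i.
  have pj : p \is j.-homog.
    by rewrite dhomogX; have := mem_nth 0%MM (ltn_ord i); rewrite ms => /andP[].
  (* Reduction modulo Q + (a) leaves [q + a * r]. The part of [r] in degree [j - d] is then reduced
     modulo [Q2], whose multiples by [a] lie in [Q]; for [d > j], [a * r] has no part in degree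
     [j]. *)
  have [p' [[q [r [Qq E]]] p'j sp']] := hreduce (adjoin_ideal a iQ) (adjoin_graded gQ iQ ad) pj.
  have Ep' : p' = \sum_(i < size s1) p'@_(nth 0%MM s1 i) *: mn s1 i.
    apply: mpoly_sum_supp => // m mp'; rewrite ms1 sp' //=.
    by apply/eqP; apply: dhomog_mf p'j _ mp'.
  have Epj : p - p' = pihomog mdeg j q + (if (d <= j)%N then a * pihomog mdeg (j - d) r else 0).
    by rewrite -(pihomogMl j r ad) -pihomogD -E pihomogB !pihomog_dE.
  have [r' [Qr' sr']] : exists r', Q (p - p' - a * r') /\
      r' = \sum_(i < size s2) r'@_(nth 0%MM s2 i) *: mn s2 i.
    rewrite Epj; case: leqP ms2 {zs2} => dj ms2; last first.
      exists 0; rewrite addr0 mulr0 subr0; split; first exact: gQ.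
      by rewrite big1 // => k _; rewrite mcoeff0 scale0r.
    have [r' [h1' h2' h3']] := hreduce iQ2 gQ2 (pihomogP (mdeg : measure N) (j - d) r).
    exists r'; split.
      by rewrite -addrA -mulrBr; apply: QD; [apply: gQ|apply: aQ2].
    apply: mpoly_sum_supp => // m mr'; rewrite ms2 h3' //=.
    by apply/eqP; apply: dhomog_mf h2' _ mr'.
  exists (fun i : 'I_(size s1) + 'I_(size s2) => match i with inl i => p'@_(nth 0%MM s1 i) | inr i => r'@_(nth 0%MM s2 i) end).
  rewrite big_sumType /= -Ep'.
  suff -> : \sum_(i < size s2) r'@_(nth 0%MM s2 i) *: (a * mn s2 i) = a * r' by rewrite opprD addrA.
  by rewrite [in RHS]sr' mulr_sumr; apply: eq_bigr => k _; rewrite scalerAr.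
move=> c Qc k.
set F := \sum_j _ in Qc.
have cF (i : 'I_(size s)) : F@_(nth 0%MM s i) = c i.
  rewrite /F raddf_sum /= (bigD1 i) //= big1 ?addr0 => [|i' ii'].
    by rewrite mcoeffZ mcoeffX eqxx mulr1.
  rewrite mcoeffZ mcoeffX nth_uniq // val_eqE.
  by rewrite (negbTE ii') mulr0.
rewrite -cF (standard_indep iQ Qc) ?mcoeff0 // => m /msupp_sum_le /flattenP[l /mapP[i _ ->]].
move/msuppZ_le; rewrite msuppX inE => /eqP->.
by have := mem_nth 0%MM (ltn_ord i); rewrite ms => /andP[].
Qed.

End Ideals.

(** * Growth along exact sequences *)

Lemma leq_nsum h k k' : (k <= k')%N -> (nsum h k <= nsum h k')%N.
Proof. by move=> kk; rewrite /nsum -(subnKC kk) -addSn big_split_ord /= leq_addr. Qed.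

Lemma nsum_shift h d k :
  (\sum_(j < k.+1) (if (d <= j)%N then h (j - d)%N else 0) =
   if (d <= k)%N then nsum h (k - d)%N else 0)%N.
Proof.
case: leqP => dk; last first.
  by rewrite big1 // => j _; rewrite leqNgt (leq_trans _ dk) // ltn_ord.
rewrite /nsum; have -> : k.+1 = (d + (k - d).+1)%N by lia.
rewrite big_split_ord /= big1 ?add0n => [|j _].
  by apply: eq_bigr => j _; rewrite leq_addr addKn.
by rewrite leqNgt ltn_ord.
Qed.

Lemma growth_lt_split h h1 h2 a d : growth_lt (nsum h1) d -> growth_lt (nsum h2) d ->
  (forall j, h j <= h1 j + (if (a <= j)%N then h2 (j - a)%N else 0))%N -> growth_lt (nsum h) d.
Proof.
move=> [C1 H1] [C2 H2] H; exists (C1 + C2)%N => k.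
have : (nsum h k <= nsum h1 k + nsum h2 k)%N.
  apply: (@leq_trans (\sum_(j < k.+1) (h1 j + (if (a <= j)%N then h2 (j - a)%N else 0)))%N).
    by apply: leq_sum => j _.
  rewrite big_split /= nsum_shift leq_add2l; case: ifP => // _.
  by apply: leq_nsum; apply: leq_subr.
have := H1 k; have := H2 k; move: (k.+1 ^ d)%N => E; rewrite mulnDl => h2' h1' le.
have : (k.+1 * nsum h k <= k.+1 * (nsum h1 k + nsum h2 k))%N by rewrite leq_mul2l le orbT.
rewrite mulnDr; lia.
Qed.

(** As [a > 0], the inequality can be unrolled at most [k.+1] times, and each time costs at most
    [nsum h1 k]. *)
Lemma growth_lt_drop h h1 a d : (0 < a)%N -> growth_lt (nsum h1) d ->
  (forall j, h j <= h1 j + (if (a <= j)%N then h (j - a)%N else 0))%N -> growth_lt (nsum h) d.+1.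
Proof.
move=> a0 [C H1] H.
have L k : (nsum h k <= k.+1 * nsum h1 k)%N.
  elim/ltn_ind: k => k IH.
  have le : (nsum h k <= nsum h1 k + (if (a <= k)%N then nsum h (k - a)%N else 0))%N.
    by rewrite -nsum_shift /nsum -big_split; apply: leq_sum => j _.
  apply: (leq_trans le); rewrite mulSn leq_add2l; case: (leqP a k) => // ak.
  have lt : (k - a < k)%N by lia.
  apply: leq_trans (IH _ lt) _.
  apply: leq_mul; first by lia.
  by apply: leq_nsum; apply: leq_subr.
exists C => k; apply: (@leq_trans (k.+1 * (k.+1 * nsum h1 k))%N); first by rewrite leq_mul2l L orbT.
by rewrite expnS mulnCA leq_mul2l H1 orbT.
Qed.

(** * Chains of prime ideals and growth *)

Section Krull.
Variables (K : fieldType) (N : nat).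
Local Notation P := {mpoly K[N]}.
Local Notation mon := 'X_{1..N}.
Implicit Types (Q : P -> Prop) (p q r : P) (m : mon).

Definition prime_pred Q : Prop :=
  [/\ ideal_pred Q, ~ Q 1 & forall p q, Q (p * q) -> Q p \/ Q q].

Lemma lew_lepm m m' : lew (val m : seq nat) (val m' : seq nat) = (m <= m')%MM.
Proof.
rewrite /lew all2E !size_tuple eqxx /=; apply/allP/mnm_lepP => [H i|H].
  have := H (m i, m' i); rewrite /=; apply.
  rewrite !mnm_tnth; apply/(nthP (0, 0)%N); exists i.
    by rewrite size_zip !size_tuple minnn.
  by rewrite nth_zip ?size_tuple // !(tnth_nth 0%N).
move=> /= [x y] /(nthP (0, 0)%N)[i]; rewrite size_zip !size_tuple minnn => iN.
rewrite nth_zip ?size_tuple //= => -[<- <-].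
by have := H (Ordinal iN); rewrite !mnm_tnth !(tnth_nth 0%N).
Qed.

Lemma dickson_mnm (f : nat -> mon) : exists i j, (i < j)%N /\ (f i <= f j)%MM.
Proof.
have [i [j [ij le]]] := @dickson N (fun i => val (val (f i))) (fun i => size_tuple (val (f i))).
by exists i, j; rewrite -lew_lepm.
Qed.

(* The ascending chain condition comes from Dickson's lemma, applied to leading
   monomials of elements witnessing strict inclusions. *)
Lemma ideal_maximal (Pr : (P -> Prop) -> Prop) Q0 : (forall Q, Pr Q -> ideal_pred Q) -> Pr Q0 ->
  exists Q, [/\ Pr Q, forall p, Q0 p -> Q p &
    forall Q', Pr Q' -> (forall p, Q p -> Q' p) -> forall p, Q' p -> Q p].
Proof.
move=> PrI Pr0; apply: contrapT => H.
pose ok Q := Pr Q /\ forall p, Q0 p -> Q p.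
have /choice[F HF] : forall Q, exists Q', ok Q ->
    [/\ ok Q', forall p, Q p -> Q' p & exists m, lead_in Q' m /\ ~ lead_in Q m].
  move=> Q; case: (EM (ok Q)) => [okQ|]; last by exists Q.
  apply: contrapT => H'; apply: H; exists Q; case: (okQ) => PrQ Q0Q; split=> // Q' PrQ' QQ' p Q'p.
  apply: contrapT => nQp; apply: H'; exists Q' => _; split=> //.
    by split=> // q /Q0Q/QQ'.
  have [p' [H1 H2]] := reduce (PrI _ PrQ) p.
  have p'0 : p' != 0 by apply: contra_notN nQp => /eqP E; move: H1; rewrite E subr0.
  exists (mlead p'); split; last by have [/asboolP] := H2 _ (mlead_supp p'0).
  exists p'; split=> //; apply: (ideal_subl (PrI _ PrQ') _ Q'p); exact: QQ'.
pose S n := iter n F Q0.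
have okS n : ok (S n) by elim: n => [|n IH]; [split|rewrite /S iterS; case: (HF _ IH)].
have Sm i j p : (i <= j)%N -> S i p -> S j p.
  move=> /subnKC <-; elim: (j - i)%N => [|k IH]; first by rewrite addn0.
  by move=> /IH; rewrite addnS /S iterS; case: (HF _ (okS (i + k)%N)) => _ + _; apply.
have /choice[m Hm] n : exists m, lead_in (S n.+1) m /\ ~ lead_in (S n) m.
  by case: (HF _ (okS n)).
have [i [j [ij le]]] := dickson_mnm m.
case: (Hm j) => _; apply.
apply: lead_in_up (PrI _ (okS j).1) le _.
by have [[p [Sp p0 E]] _] := Hm i; exists p; split=> //; apply: Sm Sp.
Qed.

Lemma pihomogM_top i j p q : (msize p <= i.+1)%N -> (msize q <= j.+1)%N ->
  pihomog mdeg (i + j) (p * q) = pihomog mdeg i p * pihomog mdeg j q.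
Proof.
move=> pi qj; rewrite {1}(pihomog_partitionE pi) {1}(pihomog_partitionE qj).
rewrite mulr_suml raddf_sum /= big_ord_recr /= big1 ?add0r => [|s _].
  rewrite mulr_sumr raddf_sum /= big_ord_recr /= big1 ?add0r => [|t _].
    by rewrite pihomog_dE //; apply: dhomogM; apply: pihomogP.
  apply: (@pihomog_ne0 _ _ _ (i + t)%N); last by apply: dhomogM; apply: pihomogP.
  by have := ltn_ord t; lia.
rewrite mulr_sumr raddf_sum /= big1 // => t _.
apply: (@pihomog_ne0 _ _ _ (s + t)%N); last by apply: dhomogM; apply: pihomogP.
by have := ltn_ord t; have := ltn_ord s; lia.
Qed.

Lemma msize_sub_top i p : (msize p <= i.+1)%N -> (msize (p - pihomog mdeg i p)%R <= i)%N.
Proof.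
move=> pi; rewrite [msize (p - _)]msizeE; apply/bigmax_leqP_seq => m.
rewrite mcoeff_msupp mcoeffB mcoeff_pihomog => + _.
case: (eqVneq (mdeg m) i) => [_|mi]; first by rewrite subrr eqxx.
rewrite subr0 -mcoeff_msupp => /msize_mdeg_lt lt.
by move: (leq_trans lt pi); rewrite ltnS leq_eqVlt (negbTE mi).
Qed.

(** The product of the top components of [p] and [q] is a component of [p * q]. One of them lies in
    [Q] and can be subtracted, which lowers the total size. *)
Lemma graded_prime Q : ideal_pred Q -> graded_pred Q -> ~ Q 1 ->
  (forall i j p q, p \is i.-homog -> q \is j.-homog -> Q (p * q) -> Q p \/ Q q) -> prime_pred Q.
Proof.
move=> iQ gQ n1 hpr; split=> // p q; have [Q0 QD QM] := iQ.
have [n] := ubnP (msize p + msize q)%N; elim: n p q => // n IH p q le Qpq.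
case: (eqVneq p 0) => [->|p0]; first by left.
case: (eqVneq q 0) => [->|q0]; first by right.
have := q0; have := p0; rewrite -!msize_poly_eq0.
case Ep : (msize p) => [|i] // _; case Eq : (msize q) => [|j] // _.
have top : Q (pihomog mdeg i p * pihomog mdeg j q).
  by rewrite -pihomogM_top ?Ep ?Eq //; apply: gQ.
case: (hpr i j _ _ (pihomogP _ _ _) (pihomogP _ _ _) top) => Qt.
- have sp : (msize (p - pihomog mdeg i p)%R <= i)%N by apply: msize_sub_top; rewrite Ep.
  case: (IH (p - pihomog mdeg i p) q) => [||Qp|Qq]; last by right.
  + by rewrite Ep Eq in le; rewrite Eq; lia.
  + by rewrite mulrBl; apply: idealB => //; rewrite mulrC; apply: QM.
  + by left; apply: ideal_subr Qt.
- have sq : (msize (q - pihomog mdeg j q)%R <= j)%N by apply: msize_sub_top; rewrite Eq.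
  case: (IH p (q - pihomog mdeg j q)) => [||Qp|Qq]; last 1 first.
  + by right; apply: ideal_subr Qt.
  + by rewrite Ep Eq in le; rewrite Ep; lia.
  + by rewrite mulrBr; apply: idealB => //; apply: QM.
  + by left.
Qed.

Definition big_growth (d : nat) Q : Prop :=
  [/\ ideal_pred Q, graded_pred Q &
    exists h, counts mdeg (standard Q) h /\ ~ growth_lt (nsum h) d].

Lemma not_big_growth d Q h : ideal_pred Q -> graded_pred Q -> ~ big_growth d Q ->
  counts mdeg (standard Q) h -> growth_lt (nsum h) d.
Proof.
move=> iQ gQ H Hh; apply: contrapT => H'; apply: H; split=> //; by exists h.
Qed.

(** If [a * b] is in [Q] with [a] and [b] homogeneous outside [Q], both Q + (a) and Q + (b) have
    smaller growth by maximality. Since Q + (b) is contained in (Q : a), the exact sequence of [a]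
    makes the growth of [Q] smaller too. *)
Lemma maximal_growth_prime d Q : big_growth d Q ->
  (forall Q', big_growth d Q' -> (forall p, Q p -> Q' p) -> forall p, Q' p -> Q p) ->
  prime_pred Q.
Proof.
move=> [iQ gQ [h [Hh nh]]] mx; have [Q0 QD QM] := iQ; apply: graded_prime => //.
  move=> Q1; apply: nh; exists 0%N => k; rewrite mul0n leqn0 muln_eq0 /= /nsum big1 // => j _.
  apply: (counts_zero Hh) => m; apply/asboolP; apply; exists 'X_[m]; split.
  - by rewrite -['X_[m]]mulr1; apply: QM.
  - by rewrite -msize_poly_eq0 msizeX.
  - by rewrite mleadXm.
move=> i j a b ai bj Qab; case: (EM (Q a)) => [|nQa]; first by left.
case: (EM (Q b)) => [|nQb]; first by right.
exfalso.
have small c k : c \is k.-homog -> ~ Q c -> forall h', counts mdeg (standard (adjoin Q c)) h' -> growth_lt (nsum h') d.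
  move=> ck nQc h'; apply: not_big_growth; first exact: adjoin_ideal.
    exact: adjoin_graded gQ iQ ck.
  move=> big; apply: nQc; apply: (mx _ big); first exact: adjoin_sub.
  exact: adjoin_gen.
have [h1 H1] := standard_exists (standard (adjoin Q a)).
have [h2 H2] := standard_exists (standard (adjoin Q b)).
apply: nh; apply: (growth_lt_split (small _ _ ai nQa _ H1) (small _ _ bj nQb _ H2)).
apply: (counts_adjoin (Q2 := adjoin Q b) iQ gQ _ _ ai _ Hh H1 H2).
- exact: adjoin_ideal.
- exact: adjoin_graded gQ iQ bj.
- move=> _ [q [r [Qq ->]]]; rewrite mulrDr; apply: QD; first exact: QM.
  by rewrite mulrA mulrC; apply: QM.
Qed.

Lemma prime_chain_exists d Q : big_growth d Q -> exists c : nat -> P -> Prop,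
  [/\ forall p, Q p -> c 0%N p, forall i, (i <= d)%N -> prime_pred (c i) &
   forall i, (i < d)%N -> (forall p, c i p -> c i.+1 p) /\ exists p, c i.+1 p /\ ~ c i p].
Proof.
elim: d Q => [|d IH] Q big.
  have [Qm [bigm QQm mx]] := ideal_maximal (fun Q (H : big_growth 0 Q) => let: And3 i _ _ := H in i) big.
  exists (fun _ => Qm); split=> // i _; exact: maximal_growth_prime bigm mx.
have [Qm [bigm QQm mx]] := ideal_maximal (fun Q (H : big_growth d.+1 Q) => let: And3 i _ _ := H in i) big.
have Qmp := maximal_growth_prime bigm mx.
case: (bigm) => iQ gQ [h [Hh nh]]; have [Q0 QD QM] := iQ.
(* Otherwise the only possible standard monomial is 1, and [nsum h] is at most 1, too small for
   order [d.+1]. *)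
have [m [m0 nm]] : exists m, m != 0%MM /\ ~ Qm 'X_[m].
  apply: contrapT => H; apply: nh; exists 1%N => k; rewrite mul1n expnS leq_mul2l /=.
  apply: (@leq_trans 1); last by rewrite expn_gt0.
  rewrite /nsum big_ord_recl big1 ?addn0 => [|j _].
    have [s [us ms <-]] := Hh 0%N.
    rewrite (@uniq_leq_size _ s [:: 0%MM]) // => m; rewrite ms mdeg_eq0 => /andP[_ /eqP->].
    by rewrite inE.
  have [s [us ms <-]] := Hh (lift ord0 j); apply/eqP; rewrite size_eq0.
  case: s us ms => // m s _ /(_ m); rewrite mem_head => /esym/andP[/asboolP sm /eqP mj].
  case: sm; exists 'X_[m]; split; [|by rewrite -msize_poly_eq0 msizeX|by rewrite mleadXm].
  apply: contrapT => nm; apply: H; exists m; split=> //.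
  by apply/eqP => m0; move: mj; rewrite m0 mdeg0.
have Xm : ('X_[m] : P) \is (mdeg m).-homog by rewrite dhomogX.
have [h1 H1] := standard_exists (standard (adjoin Qm ('X_[m] : P))).
have [|c [c0 cp cs]] := IH (adjoin Qm 'X_[m]).
  split; [exact: adjoin_ideal|exact: adjoin_graded gQ iQ Xm|exists h1; split=> // sm].
  (* Multiplication by ['X_[m]] on P/Qm has cokernel P/(Qm + ('X_[m])): the inequality of
     [counts_adjoin] holds with [Q2 = Qm]. *)
  apply: nh; apply: (growth_lt_drop (a := mdeg m) _ sm); first by rewrite lt0n mdeg_eq0.
  by apply: (counts_adjoin iQ gQ iQ gQ Xm _ Hh H1 Hh) => r Qr; apply: QM.
exists (fun i => if i is i'.+1 then c i' else Qm); split=> //.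
  by case=> // i; rewrite ltnS => /cp.
case=> [_|i]; last by rewrite ltnS => /cs.
split=> [p Qp|]; first by apply: c0; apply: adjoin_sub.
by exists 'X_[m]; split=> //; apply: c0; apply: adjoin_gen.
Qed.

Definition deg_le p (D : nat) : Prop := (mdeg (mlead p) <= D)%N.

Lemma deg_leM p q D E : deg_le p D -> deg_le q E -> deg_le (p * q) (D + E).
Proof.
rewrite /deg_le => pD qE; apply: leq_trans (lemc_mdeg (mleadM_le p q)) _.
by rewrite mdegD leq_add.
Qed.

Lemma deg_leX p i D : deg_le p D -> deg_le (p ^+ i) (i * D).
Proof.
move=> pD; elim: i => [|i IH]; first by rewrite expr0 /deg_le mlead1 mdeg0.
by rewrite exprS mulSn; apply: deg_leM.
Qed.

(* Elements f_i of p_i \ p_(i-1) along a chain of primes are algebraically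
   independent modulo p_0. *)
Lemma chain_indep (r : nat) (c : nat -> P -> Prop) :
  (forall i, (i <= r)%N -> prime_pred (c i)) ->
  (forall i, (i < r)%N -> (forall p, c i p -> c i.+1 p) /\ exists p, c i.+1 p /\ ~ c i p) ->
  exists D : nat, forall k, exists (J : finType) (x : J -> P),
    [/\ #|J| = (k.+1 ^ r)%N, forall j, deg_le (x j) (k * D) &
     forall a : J -> K, c 0%N (\sum_j a j *: x j) -> forall j, a j = 0].
Proof.
elim: r c => [|r IH] c cp cs.
  exists 0%N => k; exists 'I_1, (fun _ => 1); split=> [|_|a].
  - by rewrite card_ord.
  - by rewrite /deg_le mlead1 mdeg0.
  case: (cp 0%N (leqnn _)) => iQ n1 _; rewrite big_ord1 => H j; rewrite (ord1 j).
  apply/eqP; apply: contraT => a0; case: n1.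
  by have := idealZ iQ (a ord0)^-1 H; rewrite scalerA mulVf // scale1r.
have [D HD] : _ := IH (fun i => c i.+1) (fun i => cp i.+1) (fun i => cs i.+1).
have [c01 [f [f1 f0]]] := cs 0%N (ltn0Sn _).
have [iQ0 _ pr0] := cp 0%N (leq0n _).
have [iQ1 _ _] := cp 1%N (ltn0Sn _).
(* Powers of [f] up to [k] are multiplied with the family of the chain starting at [c 1]; the
   degrees add up to at most [k] times this constant. *)
exists (mdeg (mlead f) + D)%N => k; have [J [x [cJ xD xi]]] := HD k.
exists ('I_k.+1 * J)%type, (fun u : 'I_k.+1 * J => f ^+ u.1 * x u.2); split=> [|[i j]|a Ha].
- by rewrite card_prod card_ord cJ expnS.
- rewrite mulnDr; apply: deg_leM => //=; apply: leq_trans (deg_leX i (leqnn _)) _.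
  by rewrite leq_mul2r -ltnS ltn_ord orbT.
pose e (i : 'I_k.+1) := \sum_j a (i, j) *: x j.
have {Ha} : c 0%N (\sum_(i < k.+1) f ^+ i * e i).
  suff <- : \sum_u a u *: (f ^+ u.1 * x u.2) = \sum_(i < k.+1) f ^+ i * e i by [].
  rewrite (eq_bigr (fun i : 'I_k.+1 => \sum_j a (i, j) *: (f ^+ i * x j))); last first.
    by move=> i _; rewrite mulr_sumr; apply: eq_bigr => j _; rewrite scalerAr.
  by rewrite pair_big /=; apply: eq_bigr => -[i j] _.
have vanish i : c 1%N (e i) -> e i = 0.
  by move=> /xi H; rewrite /e big1 // => j _; rewrite H scale0r.
suff van : forall i, e i = 0 -> forall j, a (i, j) = 0.
  suff all0 n (g : 'I_n -> P) : (forall i, c 1%N (g i) -> g i = 0) ->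
      c 0%N (\sum_(i < n) f ^+ i * g i) -> forall i, g i = 0.
    by move=> H [i j]; apply: van; apply: (all0 _ e vanish H).
  elim: n g => [|n IHn] g vg; first by move=> _ [].
  rewrite big_ord_recl expr0 mul1r.
  have -> : \sum_(i < n) f ^+ (lift ord0 i) * g (lift ord0 i) = f * \sum_(i < n) f ^+ i * g (lift ord0 i).
    by rewrite mulr_sumr; apply: eq_bigr => i _; rewrite exprS mulrA.
  (* Modulo [c 1], which contains [f], only [g ord0] survives, so it vanishes. The rest is divisible
     by [f], which cancels because [c 0] is prime and does not contain it. *)
  move=> H; have [_ QD1 QM1] := iQ1.
  have g0 : g ord0 = 0.
    apply: vg; have := idealB iQ1 (c01 _ H) (QM1 (\sum_(i < n) f ^+ i * g (lift ord0 i)) f f1).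
    by rewrite [X in _ - X]mulrC addrK.
  rewrite g0 add0r in H; case: (pr0 _ _ H) => // H' i.
  case: (unliftP ord0 i) => [i' ->|-> //].
  by apply: (IHn (fun i => g (lift ord0 i))) => // i''; apply: vg.
move=> i ei0 j; apply: (xi (fun j => a (i, j))).
by rewrite -/(e i) ei0; case: (iQ1).
Qed.

(** The [k.+1 ^ r] elements given by [chain_indep] are independent modulo [Q] and reduce to standard
    monomials of degree at most [k * D], of which there are O(k^d). *)
Lemma chain_length (r d C : nat) (c : nat -> P -> Prop) Q h : ideal_pred Q -> counts mdeg (standard Q) h ->
  (forall k, nsum h k <= C * k.+1 ^ d)%N ->
  (forall p, Q p -> c 0%N p) ->
  (forall i, (i <= r)%N -> prime_pred (c i)) ->
  (forall i, (i < r)%N -> (forall p, c i p -> c i.+1 p) /\ exists p, c i.+1 p /\ ~ c i p) ->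
  (r <= d)%N.
Proof.
move=> iQ Hh HC Qc cp cs; have [D HD] := chain_indep cp cs.
rewrite leqNgt; apply/negP => dr.
have bound k : (k.+1 ^ r <= C * D.+1 ^ d * k.+1 ^ d)%N.
  have [J [x [<- xD xi]]] := HD k.
  have [s [us ms zs]] := counts_prefix (k * D).+1 Hh.
  have sz : size s = nsum h (k * D).
    have := zs (fun _ => 1%N); rewrite sum1_size => ->.
    by apply: eq_bigr => i _; rewrite muln1.
  apply: (@leq_trans #|'I_(size s)|); last first.
    rewrite card_ord sz; apply: leq_trans (HC _) _.
    rewrite -mulnA -expnMn leq_mul2l leq_expl ?orbT //.
    by rewrite mulSn mulnS; lia.
  apply: (indep_le_span (Q := Q) (x := x) (y := fun i : 'I_(size s) => 'X_[nth 0%MM s i])) => //.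
    move=> j; have [p' [H1 H2]] := reduce iQ (x j).
    exists (fun i : 'I_(size s) => p'@_(nth 0%MM s i)).
    rewrite -mpoly_sum_supp // => m mp'; have [sm le] := H2 m mp'.
    rewrite ms sm ltnS /=; apply: leq_trans (xD j); exact: lemc_mdeg.
  by move=> a /Qc; apply: xi.
(* At this [k], called [X], the bound reads (X+1)^r <= X (X+1)^d, which is false for r > d. *)
have := bound (C * D.+1 ^ d)%N; set X := (C * _)%N.
have : (X.+1 * X.+1 ^ d <= X.+1 ^ r)%N by rewrite -expnS leq_pexp2l.
move=> h1 h2; have := leq_trans h1 h2; rewrite leq_pmul2r ?expn_gt0 // ltnn //.
Qed.

End Krull.

(** * Prime ideals of the quotient ring *)

Section QuotientPrime.
Local Open Scope quotient_scope.
Variables (K : fieldType) (N : nat) (I : idealr {mpoly K[N]}).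
Local Notation P := {mpoly K[N]}.
Local Notation R := {ideal_quot I}.

Lemma pi_eq0 p : (\pi_R p = 0) <-> p \in I.
Proof.
rewrite -[0 in X in X <-> _](rmorph0 (\pi_R : P -> R)).
by split=> [/eqP|H]; [|apply/eqP]; rewrite -Quotient.idealrBE subr0.
Qed.

Lemma pi_sub p q : (\pi_R p = \pi_R q) <-> p - q \in I.
Proof. by rewrite Quotient.idealrBE; split=> /eqP. Qed.

Lemma repr_pi p : repr (\pi_R p) - p \in I.
Proof. by apply/pi_sub; rewrite reprK. Qed.

Lemma idealr_pred : ideal_pred (fun p : P => p \in I).
Proof.
split=> [|p q|p q]; [exact: rpred0|exact: rpredD|exact: idealMr].
Qed.

Variables (Q : P -> Prop) (primeQ : prime_pred Q) (subQ : forall p, p \in I -> Q p).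

(** The image of [Q] in P/I; the choice of representative is immaterial since [Q] contains [I]. *)
Definition quot_pred : R -> bool := fun x => `[< Q (repr x) >].

Lemma quot_predE p : (\pi_R p \in quot_pred) <-> Q p.
Proof.
have [iQ _ _] := primeQ; have S := subQ (repr_pi p).
rewrite unfold_in /=; split=> [/asboolP|] H; first exact: (ideal_subl iQ S H).
by apply/asboolP; apply: (ideal_subr iQ S H).
Qed.

Lemma quot_pred_ideal : idealr_closed quot_pred.
Proof.
have [[Q0 QD QM] n1 _] := primeQ; split.
- by rewrite -(rmorph0 (\pi_R : P -> R)); apply/quot_predE.
- by rewrite -(rmorph1 (\pi_R : P -> R)); apply/negP => /quot_predE.
move=> a u v; rewrite -[a]reprK -[u]reprK -[v]reprK => /quot_predE Qu /quot_predE Qv.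
by rewrite -rmorphM -rmorphD; apply/quot_predE; apply: QD => //; apply: QM.
Qed.

Lemma quot_pred_prime : prime_idealr_closed quot_pred.
Proof.
have [_ _ pr] := primeQ; move=> u v; rewrite -[u]reprK -[v]reprK -rmorphM.
by move=> /quot_predE/pr[] H; apply/orP; [left|right]; apply/quot_predE.
Qed.

HB.instance Definition _ := isIdealr.Build R quot_pred quot_pred_ideal.
HB.instance Definition _ := isPrimeIdealrClosed.Build R quot_pred quot_pred_prime.

Definition quot_prime : prime_idealr R := quot_pred.

End QuotientPrime.

Section IdealHilbert.
Local Open Scope quotient_scope.
Variables (K : fieldType) (N : nat) (I : idealr {mpoly K[N]}).
Hypothesis gI : graded_ideal I.
Local Notation P := {mpoly K[N]}.
Local Notation R := {ideal_quot I}.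
Local Notation stdI := (standard (fun p : P => p \in I)).
Variables (h : nat -> nat) (d e : nat).
Hypotheses (Hh : counts mdeg stdI h) (pole : hilbert_pole h d e).

Lemma krull_dim_pole : krull_dim R d.
Proof.
have iI := idealr_pred I.
split=> [|r [p Hp]].
  have [|c [Ic cp cs]] := @prime_chain_exists K N d (fun p : P => p \in I).
    split; [exact: iI|by move=> j q; apply: gI|].
    by exists h; split=> //; apply: hilbert_pole_lower pole.
  have mono i j : (i <= j)%N -> (j <= d)%N -> forall q, c i q -> c j q.
    move=> /subnKC <-; elim: (j - i)%N => [|k IH] jd q cq; first by rewrite addn0.
    rewrite addnS in jd *; apply: (cs _ jd).1; apply: IH => //; exact: ltnW.
  have cI (i : 'I_d.+1) q : q \in I -> c i q by move=> /Ic; apply: mono => //; rewrite -ltnS.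
  have cP (i : 'I_d.+1) : prime_pred (c i) by apply: cp; rewrite -ltnS.
  exists (fun i => quot_prime (cP i) (@cI i)) => a b ab; split=> [x|].
    rewrite -[x]reprK => /(quot_predE (cP a) (@cI a)) ca.
    apply/(quot_predE (cP b) (@cI b)); apply: mono ca; first exact: ltnW.
    by rewrite -ltnS.
  have [_ [q [cq ncq]]] := cs a (leq_trans ab (ltn_ord b)).
  exists (\pi_R q); last by apply/negP => /(quot_predE (cP a) (@cI a)).
  apply/(quot_predE (cP b) (@cI b)); apply: mono cq => //.
  by rewrite -ltnS.
have [C HC] := hilbert_pole_upper pole.
pose c i : P -> Prop := fun q => \pi_R q \in p (inord i).
apply: (@chain_length K N r d C c _ h iI Hh HC).
- by move=> q /pi_eq0 q0; rewrite /c q0 rpred0.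
- move=> i ir; split; first split.
  + by rewrite /c rmorph0 rpred0.
  + by move=> q q'; rewrite /c rmorphD; apply: rpredD.
  + by move=> q q'; rewrite /c rmorphM; apply: idealMr.
  + by rewrite /c rmorph1 idealr1.
  + by move=> q q'; rewrite /c rmorphM prime_idealrM => /orP.
move=> i ir; have ab : ((inord i : 'I_r.+1) < (inord i.+1 : 'I_r.+1))%N by rewrite !inordK // ltnS // ltnW.
have [sub [x xb xa]] := Hp _ _ ab; split=> [q|]; first exact: sub.
by exists (repr x); rewrite /c reprK; split=> //; apply/negP.
Qed.

Lemma graded_dim_hilb j : graded_dim I j (h j).
Proof.
have iI := idealr_pred I.
have [s [us ms <-]] := Hh j.
have sj (i : 'I_(size s)) : stdI (nth 0%MM s i) && (mdeg (nth 0%MM s i) == j).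
  by rewrite -ms mem_nth.
exists (fun i => 'X_[nth 0%MM s i]); split.
- by move=> i; rewrite dhomogX; case/andP: (sj i).
- move=> a /pi_eq0; set F := \sum_j _ => FI i.
  have <- : F@_(nth 0%MM s i) = a i.
    rewrite /F raddf_sum /= (bigD1 i) //= big1 ?addr0 => [|i' ii'].
      by rewrite mcoeffZ mcoeffX eqxx mulr1.
    by rewrite mcoeffZ mcoeffX nth_uniq // val_eqE (negbTE ii') mulr0.
  rewrite (standard_indep iI FI) ?mcoeff0 // => m /msupp_sum_le /flattenP[l /mapP[k _ ->]].
  by move/msuppZ_le; rewrite msuppX inE => /eqP->; case/andP: (sj k).
- move=> p pj; have [p' [H1 H2 H3]] := hreduce iI (fun j q => @gI j q) pj.
  exists (fun i : 'I_(size s) => p'@_(nth 0%MM s i)).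
  rewrite -mpoly_sum_supp //; first exact/pi_sub.
  by move=> m mp'; rewrite ms H3 //=; apply/eqP; apply: dhomog_mf H2 _ mp'.
Qed.

Lemma ideal_degree_pole : ideal_degree I e.
Proof.
case: pole => _ [g [g1 Hg]]; exists d, h, g; split=> //.
- exact: krull_dim_pole.
- exact: graded_dim_hilb.
Qed.

End IdealHilbert.

(** * Filtrations as sets of words *)

Section Push.
Variables (K : fieldType) (M N : nat) (sg : 'I_M -> 'I_N).
Implicit Types (m : 'X_{1..M}).

Definition push m : 'X_{1..N} := (\sum_v U_(sg v) *+ m v)%MM.

Lemma push_mpoly (p : {mpoly K[M]}) :
  p \mPo [tuple 'X_(sg v) | v < M] = \sum_(m <- msupp p) p@_m *: 'X_[push m].
Proof.
rewrite comp_mpolyEX; apply: eq_bigr => m _; rewrite comp_mpolyX /push -mprodXnE.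
by congr (_ *: _); apply: eq_bigr => v _; rewrite tnth_mktuple.
Qed.

Lemma mdeg_push m : mdeg (push m) = mdeg m.
Proof.
rewrite /push mdeg_sum [RHS]mdegE; apply: eq_bigr => v _.
by rewrite mdegMn mdeg1 mul1n.
Qed.

Hypothesis sg_inc : forall v v' : 'I_M, (v < v')%N -> (sg v < sg v')%N.

Lemma sg_inj : injective sg.
Proof.
move=> v v' E; apply/val_inj; case: (ltngtP v v') => // /sg_inc; rewrite E ltnn //.
Qed.

Lemma push_in m v : push m (sg v) = m v.
Proof.
rewrite /push mnm_sumE (bigD1 v) //= big1 ?addn0 => [|v' neq]; rewrite mulmnE mnm1E.
  by rewrite eqxx mul1n.
by rewrite (inj_eq sg_inj) (negbTE neq).
Qed.

Lemma push_out m w : (forall v, sg v != w) -> push m w = 0%N.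
Proof.
move=> nw; rewrite /push mnm_sumE big1 // => v _.
by rewrite mulmnE mnm1E (negbTE (nw v)).
Qed.

(** In equal degree the order is decided by the first variable with different exponents. An
    increasing [sg] preserves which one is first, and variables outside its image have exponent 0 on
    both sides. *)
Lemma push_lt m m' : (m < m')%O -> (push m < push m')%O.
Proof.
move=> lt; case: (ltngtP (mdeg m) (mdeg m')) => E.
- by apply: lt_mdeg_ltmc; rewrite !mdeg_push.
- by move: (lemc_mdeg (ltW lt)); rewrite leqNgt E.
move/(ltmcP E): lt => [v eqv ltv].
apply/ltmcP; first by rewrite !mdeg_push.
exists (sg v) => [w wv|]; last by rewrite !push_in.
case: (pickP (fun u => sg u == w)) => [u /eqP uw|nw]; last first.
  by rewrite !push_out // => u; rewrite nw.
rewrite -uw !push_in; apply: eqv; rewrite ltnNge; apply/negP => vu.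
move: wv; rewrite -uw ltnNge; case/negP; move: vu; rewrite leq_eqVlt => /predU1P[|/sg_inc/ltnW//].
by move/val_inj->.
Qed.

Lemma push_inj : injective push.
Proof. by move=> m m' E; apply/mnmP => v; rewrite -!push_in E. Qed.

Lemma mlead_push (p : {mpoly K[M]}) : p != 0 ->
  p \mPo [tuple 'X_(sg v) | v < M] != 0 /\
  mlead (p \mPo [tuple 'X_(sg v) | v < M]) = push (mlead p).
Proof.
move=> p0; rewrite push_mpoly; set q := \sum_(m <- _) _.
have qc : q@_(push (mlead p)) = p@_(mlead p).
  rewrite /q raddf_sum /= (bigD1_seq (mlead p)) ?msupp_uniq ?mlead_supp //=.
  rewrite big1 ?addr0 => [|m nm]; rewrite mcoeffZ mcoeffX ?eqxx ?mulr1 //.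
  by rewrite (inj_eq push_inj) (negbTE nm) mulr0.
have qs : push (mlead p) \in msupp q by rewrite mcoeff_msupp qc mleadc_eq0.
have q0 : q != 0 by apply: contraTneq qs => ->; rewrite msupp0.
split=> //; apply/eqP; rewrite eq_le msupp_le_mlead // andbT.
have := mlead_supp q0 => /msupp_sum_le /flattenP[l /mapP[m mp ->]].
rewrite filter_predT in mp => /msuppZ_le; rewrite msuppX inE => /eqP->.
have := msupp_le_mlead mp; rewrite [(m <= _)%O]le_eqVlt => /predU1P[->|/push_lt/ltW].
  exact: le_refl.
by [].
Qed.

End Push.

Lemma index_allpairs (T1 T2 : eqType) (s : seq T1) (t : seq T2) x y : x \in s -> y \in t ->
  index (x, y) [seq (a, b) | a <- s, b <- t] = (index x s * size t + index y t)%N.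
Proof.
move=> + yt; elim: s => //= a s IH; rewrite in_cons index_cat.
have mem z : ((x, y) \in [seq (z, b) | b <- t]) = (x == z).
  apply/mapP/eqP => [[b _ [-> _]]//|->]; by exists y.
rewrite mem; case: (eqVneq x a) => [<- _|xa /= xs].
  by rewrite ?eqxx mul0n add0n index_map // => b b' [].
by rewrite ?(eq_sym a) ?(negbTE xa) size_map IH // mulSn addnA.
Qed.

Lemma enum_rank_pair (c n : nat) (j : 'I_c) (k : 'I_n) : enum_rank (j, k) = (j * n + k)%N :> nat.
Proof.
have sz : (enum_rank (j, k) < size (enum {: 'I_c * 'I_n}))%N by rewrite -cardE.
rewrite -(index_uniq (j, k) sz (enum_uniq _)) nth_enum_rank.
have -> : enum {: 'I_c * 'I_n} = [seq (a, b) | a <- enum 'I_c, b <- enum 'I_n].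
  by rewrite enumT unlock.
by rewrite index_allpairs ?mem_enum // !index_enum_ord size_enum_ord.
Qed.

Section Words.
Variable c : nat.

Definition act_var (m n : nat) (f : 'I_m -> 'I_n) (v : 'I_(nvars c m)) : 'I_(nvars c n) :=
  enum_rank ((enum_val v).1, f (enum_val v).2).

(** Variables with the same first index form consecutive blocks in both rings, and inside a block
    they are ordered by the index on which [f] acts. This makes [mlead_push] applicable to
    [act f]. *)
Lemma act_var_inc (m n : nat) (f : 'I_m -> 'I_n) :
  (forall k k' : 'I_m, (k < k')%N -> (f k < f k')%N) ->
  forall v v' : 'I_(nvars c m), (v < v')%N -> (act_var f v < act_var f v')%N.
Proof.
move=> f_inc v v'; rewrite /act_var -{1}(enum_valK v) -{1}(enum_valK v').
case: (enum_val v) => j k; case: (enum_val v') => j' k'; rewrite !enum_rank_pair /=.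
case: (ltngtP j j') => jj.
- move=> _; have h : (j.+1 * n <= j' * n)%N by rewrite leq_mul2r jj orbT.
  by have := ltn_ord (f k); rewrite mulSn in h; lia.
- have h : (j'.+1 * m <= j * m)%N by rewrite leq_mul2r jj orbT.
  by have := ltn_ord k'; rewrite mulSn in h; lia.
- by rewrite (val_inj jj) !ltn_add2l; apply: f_inc.
Qed.

Definition mnm_word (n : nat) (w : seq (seq nat)) : 'X_{1..nvars c n} :=
  [multinom nth 0%N (nth [::] w (enum_val v).2) (enum_val v).1 | v < nvars c n].

Definition word_mnm (n : nat) (m : 'X_{1..nvars c n}) : seq (seq nat) :=
  [seq [seq m (enum_rank (j, k)) | j <- enum 'I_c] | k <- enum 'I_n].

Definition wf_word (n : nat) (w : seq (seq nat)) : bool :=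
  (size w == n) && all (fun b => size b == c) w.

Lemma word_mnm_wf n m : wf_word n (@word_mnm n m).
Proof.
rewrite /wf_word size_map size_enum_ord eqxx all_map; apply/allP => k _ /=.
by rewrite size_map size_enum_ord.
Qed.

Lemma nth_word_mnm n (m : 'X_{1..nvars c n}) (j : 'I_c) (k : 'I_n) :
  nth 0%N (nth [::] (word_mnm m) k) j = m (enum_rank (j, k)).
Proof.
by rewrite (nth_map k) ?size_enum_ord // (nth_map j) ?size_enum_ord // !nth_ord_enum.
Qed.

Lemma word_mnmK n (m : 'X_{1..nvars c n}) : mnm_word n (word_mnm m) = m.
Proof.
apply/mnmP => v; rewrite mnmE nth_word_mnm -[in RHS](enum_valK v).
by case: (enum_val v).
Qed.

Lemma wf_word_ext n w w' : wf_word n w -> wf_word n w' ->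
  (forall (j : 'I_c) (k : 'I_n), nth 0%N (nth [::] w k) j = nth 0%N (nth [::] w' k) j) -> w = w'.
Proof.
move=> /andP[/eqP sw /allP aw] /andP[/eqP sw' /allP aw'] H.
apply: (@eq_from_nth _ [::]); first by rewrite sw.
move=> k; rewrite sw => kn.
have s1 : size (nth [::] w k) = c by apply/eqP/aw/mem_nth; rewrite sw.
have s2 : size (nth [::] w' k) = c by apply/eqP/aw'/mem_nth; rewrite sw'.
apply: (@eq_from_nth _ 0%N); first by rewrite s1.
by move=> j; rewrite s1 => jc; apply: (H (Ordinal jc) (Ordinal kn)).
Qed.

Lemma mnm_word_rank n w (j : 'I_c) (k : 'I_n) :
  mnm_word n w (enum_rank (j, k)) = nth 0%N (nth [::] w k) j.
Proof. by rewrite mnmE enum_rankK. Qed.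

Lemma mnm_wordK n w : wf_word n w -> word_mnm (mnm_word n w) = w.
Proof.
move=> ww; apply: (wf_word_ext (word_mnm_wf _) ww) => j k.
by rewrite nth_word_mnm mnm_word_rank.
Qed.

Lemma mdeg_mnm_word n w : wf_word n w -> mdeg (mnm_word n w) = sumn (map sumn w).
Proof.
move=> /andP[/eqP sw /allP aw]; rewrite mdegE.
rewrite (reindex (@enum_rank ('I_c * 'I_n)%type)) /=; last by apply: onW_bij; apply: enum_rank_bij.
rewrite (eq_bigr (fun u : 'I_c * 'I_n => nth 0%N (nth [::] w u.2) u.1)); last first.
  by move=> [j k] _; rewrite mnm_word_rank.
rewrite -(pair_big xpredT xpredT (fun (j : 'I_c) (k : 'I_n) => nth 0%N (nth [::] w k) j)) /=.
rewrite exchange_big /= sumnE big_map (big_nth [::]) sw big_mkord.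
apply: eq_bigr => k _; rewrite sumnE (big_nth 0%N).
by have /eqP-> : size (nth [::] w k) == c by [apply/aw/mem_nth; rewrite sw]; rewrite big_mkord.
Qed.

End Words.

Lemma lew_nth a b j : lew a b -> (nth 0%N a j <= nth 0%N b j)%N.
Proof.
elim: a b j => [|x a IH] [|y b] [|j] //=; rewrite /lew /= => /andP[xy ab] //.
exact: IH.
Qed.

(** The matched positions are extended past the end of [u] by a translate of the identity, which
    gives a strictly increasing map on all of [nat]. *)
Lemma emb_inc k u w : emb lew k u w -> exists pi : nat -> nat,
  [/\ inc_monoid k pi, forall l, (l < size u)%N -> (pi l < size w)%N &
   forall l, (l < size u)%N -> lew (nth [::] u l) (nth [::] w (pi l))].
Proof.
elim: w k u => [|b w IH] k [|a u] //=; [by exists id; split => //; split|by exists id; split => //; split|].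
have shift k' : (exists pi : nat -> nat, [/\ inc_monoid k' pi,
    forall l, (l < size u)%N -> (pi l < size w)%N &
    forall l, (l < size u)%N -> lew (nth [::] u l) (nth [::] w (pi l))]) -> lew a b ->
    exists pi : nat -> nat, [/\ inc_monoid k'.+1 pi,
      forall l, (l < (size u).+1)%N -> (pi l < (size w).+1)%N &
      forall l, (l < (size u).+1)%N -> lew (nth [::] (a :: u) l) (nth [::] (b :: w) (pi l))].
  move=> [pi [[pinc pfix] psz ple]] ab.
  exists (fun l => if l is l'.+1 then (pi l').+1 else 0%N); split.
  - by split=> [[|x] [|y] // xy|[|x] //]; [apply: pinc|rewrite ltnS => /pfix ->].
  - by case=> // l; rewrite !ltnS; apply: psz.
  - by case=> // l /=; rewrite ltnS; apply: ple.
case: k => [|k]; last by case/andP => ab /IH H; apply: shift.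
case: ifP => [ab /IH H|_ /IH[pi [[pinc pfix] psz ple]]].
  by have [pi [[pinc pfix] psz ple]] := shift _ H ab; exists pi.
by exists (fun l => (pi l).+1); split.
Qed.

Section Invariance.
Variables (K : fieldType) (c : nat) (I : forall n, idealr {mpoly K[nvars c n]}).

Local Notation inI n := (lead_in (fun p : {mpoly K[nvars c n]} => p \in I n)).

(** The map [f] read off the embedding sends a polynomial with leading monomial [u] to one with
    leading monomial [push u], which divides the monomial of [w]. *)
Lemma lead_in_emb i (m n : nat) u w : inc_invariant i I -> (0 < m)%N ->
  wf_word c m u -> wf_word c n w -> emb lew i u w -> inI m (mnm_word c m u) -> inI n (mnm_word c n w).
Proof.
move=> inv m0 wu ww /emb_inc[pi [mpi psz ple]] [p [Ip p0 Ep]].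
have [/eqP su _] := andP wu; have [/eqP sw _] := andP ww.
have [pinc pfix] := mpi.
have pge l : (l <= pi l)%N.
  by elim: l => // l IH; apply: leq_ltn_trans IH _; apply: pinc.
have pn (l : 'I_m) : (pi l < n)%N by rewrite -sw; apply: psz; rewrite su.
have mn : (m <= n)%N.
  have := pn (Ordinal (ltac:(by rewrite prednK) : m.-1 < m)%N) => /=.
  by move=> h; have := leq_ltn_trans (pge _) h; rewrite prednK.
pose f (l : 'I_m) : 'I_n := Ordinal (pn l).
have f_inc (l l' : 'I_m) : (l < l')%N -> (f l < f l')%N by apply: pinc.
have Iq : act f p \in I n by apply: (inv m n _ pi) => //; rewrite m0 mn.
have [q0 Eq] := mlead_push (act_var_inc f_inc) p0.
apply: (@lead_in_up _ _ _ (push (act_var f) (mnm_word c m u))).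
- split=> [|a b|a b]; [exact: rpred0|exact: rpredD|exact: idealMr].
- apply/mnm_lepP => w'; case: (pickP (fun v => act_var f v == w')) => [v /eqP <-|nw]; last first.
    by rewrite push_out // => v; rewrite nw.
  rewrite (push_in (act_var_inc f_inc)) /act_var mnm_word_rank mnmE /=.
  by apply: lew_nth; apply: ple; rewrite su.
- by exists (act f p); split=> //; rewrite -Ep -Eq.
Qed.

Lemma perm_extends (m n : nat) (le_mn : (m <= n)%N) (f : 'I_m -> 'I_n) : injective f ->
  exists s : 'S_n, forall k, s (widen_ord le_mn k) = f k.
Proof.
move=> f_inj; suff H j : (j <= m)%N -> exists s : 'S_n, forall k : 'I_m, (k < j)%N -> s (widen_ord le_mn k) = f k.
  by have [s Hs] := H m (leqnn m); exists s => k; apply: Hs.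
elim: j => [|j IH] jm; first by exists 1%g.
have [s Hs] := IH (ltnW jm); pose j' := Ordinal jm.
exists (s * tperm (s (widen_ord le_mn j')) (f j'))%g => k; rewrite ltnS leq_eqVlt permM => /predU1P[kj|kj].
  by have -> : k = j' by [apply: val_inj]; rewrite tpermL.
rewrite (Hs k kj) tpermD //; last by apply: contraTneq kj => /f_inj <-; rewrite ltnn.
rewrite -(Hs k kj); apply: contraTneq kj => /perm_inj/(congr1 val) /= <-.
by rewrite ltnn.
Qed.

(** An increasing map is injective on the first [m] indices, where it therefore coincides with a
    permutation of ['I_n]. *)
Lemma sym_inc_invariant : sym_invariant I -> inc_invariant 0 I.
Proof.
move=> inv m n /andP[m0 mn] pi f [pinc _] fpi p Ip.
have f_inj : injective f.
  move=> k k' E; apply/val_inj; case: (ltngtP k k') => // /pinc.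
    by rewrite -!fpi E ltnn.
  by rewrite -!fpi E ltnn.
have [s Hs] := perm_extends mn f_inj.
have -> : act f p = act (s \o widen_ord mn) p.
  by congr (act _ p); apply: funext => k /=; rewrite Hs.
exact: inv.
Qed.

End Invariance.

(** * Hilbert series of the ideals in the filtration *)

Lemma standard_pole (K : fieldType) (N : nat) (I : idealr {mpoly K[N]}) h c :
  counts mdeg (standard (fun p => p \in I)) h -> polar c h -> exists d e, hilbert_pole h d e.
Proof.
move=> Hh [h0|[d [e [_ H]]]]; last by exists d, e.
(* Properness rules out the zero series: if 1 were a leading monomial, the ideal would contain a
   nonzero constant. *)
suff /(counts_nonzero Hh) : standard (fun p => p \in I) 0%MM by rewrite h0.
apply/asboolP => -[p [Ip p0 E]].
have Ep : p = (p@_0)%:MP by apply: msize1_polyC; rewrite -(mlead_deg p0) E mdeg0.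
have c0 : p@_0 != 0 by rewrite -E mleadc_eq0.
have := idealMr ((p@_0)^-1)%:MP Ip; rewrite Ep mcoeffC eqxx mulr1 -mpolyCM mulVf //.
by rewrite mpolyC1 idealr1.
Qed.

Definition mnm_seq (N : nat) (b : seq nat) : 'X_{1..N} := [multinom nth 0%N b i | i < N].

Lemma mnm_seqK (N : nat) (m : 'X_{1..N}) : mnm_seq N (val m) = m.
Proof. by apply/mnmP => i; rewrite mnmE mnm_tnth (tnth_nth 0%N). Qed.

Lemma mnm_seq_inj N b b' : size b = N -> size b' = N -> mnm_seq N b = mnm_seq N b' -> b = b'.
Proof.
move=> sb sb' E; apply: (@eq_from_nth _ 0%N); rewrite ?sb // => i iN.
by have := congr1 (fun m : 'X_{1..N} => m (Ordinal iN)) E; rewrite !mnmE.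
Qed.

Lemma mdeg_mnm_seq N b : size b = N -> mdeg (mnm_seq N b) = sumn b.
Proof.
move=> sb; rewrite mdegE sumnE (big_nth 0%N) sb big_mkord.
by apply: eq_bigr => i _; rewrite mnmE.
Qed.

Lemma seq_bounded (s : seq nat) : exists e, forall x, x \in s -> (x <= e)%N.
Proof.
exists (\max_(x <- s) x)%N => x xs; rewrite (big_rem x) //=; exact: leq_maxl.
Qed.

(** The Hilbert series of a single ideal. It supplies the degrees of the finitely many [I n] that
    the asymptotic description does not reach. *)
Lemma standard_hilbert (K : fieldType) (N : nat) (I : idealr {mpoly K[N]}) :
  exists h d e, counts mdeg (standard (fun p => p \in I)) h /\ hilbert_pole h d e.
Proof.
set Q := (fun p => p \in I); have iI : ideal_pred Q := idealr_pred I.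
have [S [SU SB]] := wqo_finite_basis (U := fun b => size b = N /\ lead_in Q (mnm_seq N b))
  (@dickson N) (fun b H => H.1).
have [e He] := seq_bounded (flatten S).
have lew_mnm b b' : size b = N -> size b' = N -> lew b b' -> (mnm_seq N b <= mnm_seq N b')%MM.
  by move=> sb sb' bb; apply/mnm_lepP => i; rewrite !mnmE; apply: lew_nth.
have E b : size b = N -> standard Q (mnm_seq N b) = ~~ has (fun g => lew g b) S.
  move=> sb; apply/asboolP/hasPn => [nl g gS|H /(conj sb)/SB[g gS gb]].
    by apply/negP => gb; have [sg lg] := SU g gS; apply: nl; apply: lead_in_up (lew_mnm _ _ sg sb gb) lg.
  by move: (H g gS); rewrite gb.
have [|h [Hh ph]] := @counts_truncated N e (fun b => standard Q (mnm_seq N b)).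
  move=> b sb; rewrite -/(trunc e b) !E // ?size_map //; congr negb; apply: eq_in_has => g gS.
  by apply: lew_trunc => x xg; apply: He; apply/flattenP; exists g.
have Hs : counts mdeg (standard Q) h.
  apply: (counts_bij (f := mnm_seq N)) Hh.
  - by move=> b b' /andP[/eqP sb _] /andP[/eqP sb' _]; apply: mnm_seq_inj.
  - by move=> b /andP[/eqP sb bQ]; split=> //; apply: mdeg_mnm_seq.
  - move=> m mQ; exists (val (val m)); last by rewrite mnm_seqK.
    by rewrite size_tuple eqxx mnm_seqK.
have [d [e' pole]] := standard_pole Hs ph.
by exists h, d, e'.
Qed.

Lemma standard_words (K : fieldType) (c n : nat) (I : idealr {mpoly K[nvars c n]}) A h :
  (forall w, A w = wf_word c n w && standard (fun p => p \in I) (mnm_word c n w)) ->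
  counts wdeg A h -> counts mdeg (standard (fun p => p \in I)) h.
Proof.
move=> HA; apply: (counts_bij (f := mnm_word c n)).
- move=> w w'; rewrite !HA => /andP[ww _] /andP[ww' _] E.
  by rewrite -(mnm_wordK ww) E mnm_wordK.
- by move=> w; rewrite HA => /andP[ww st]; split=> //; apply: mdeg_mnm_word.
- move=> m ms; exists (word_mnm m); last by rewrite word_mnmK.
  by rewrite HA word_mnm_wf word_mnmK.
Qed.

Lemma inc_filtration_good (K : fieldType) (c i : nat) (I : forall n, idealr {mpoly K[nvars c n]}) :
  inc_invariant i I -> exists h, good c h /\
    forall n, (i < n)%N -> counts mdeg (standard (fun p : {mpoly K[nvars c n]} => p \in I n)) (h n).
Proof.
move=> inv.
(* Leading words of all lengths above [i] are put into one set. They are nonempty, hence never refer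
   to [I 0], on which nothing is assumed. *)
pose U w := [/\ (i < size w)%N, wf_word c (size w) w &
  lead_in (fun p : {mpoly K[nvars c (size w)]} => p \in I (size w)) (mnm_word c (size w) w)].
have [|S [SU SB]] := wqo_finite_basis (U := U) (higman_rigid (k := i.+1) lew_trans (@dickson c)).
  by move=> w [iw /andP[_ /allP aw] _]; split=> // b /aw/eqP.
have [e He] := seq_bounded (flatten (flatten S)).
have bS : bounded e S.
  move=> g a x gS ag xa; apply: He; apply/flattenP; exists a => //.
  by apply/flattenP; exists g.
have [h [Hh gh]] := good_avoid c i.+1 bS.
exists h; split=> // n ni; apply: standard_words (Hh n) => w.
rewrite /avoid andbA -/(wf_word c n w); case ww : (wf_word c n w) => //=.
have /andP[/eqP sw _] := ww.
apply/hasPn/asboolP => [H lw|nl g gS].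
  have Uw : U w by split; rewrite sw.
  by have [g gS gw] := SB w Uw; move: (H g gS); rewrite gw.
apply/negP => gw; apply: nl; have [ig wg lg] := SU g gS.
apply: (@lead_in_emb K c I i.+1 (size g) n g w) => //; last exact: leq_ltn_trans ig.
(* Maps that fix one more index form a smaller monoid, so invariance passes from [i] to [i.+1]. *)
by move=> m n' mn' pi f [pinc pfix]; apply: inv => //; split=> // j ji; apply: pfix; apply: ltnW.
Qed.

Local Open Scope classical_set_scope.

Theorem theorem7p9 (K : fieldType) (R : realType) (c : nat) (hc : (1 <= c)%N)
    (I : forall n : nat, idealr {mpoly K[nvars c n]})
    (hgraded : forall n, (1 <= n)%N -> graded_ideal (I n))
    (hinv : (exists i : nat, inc_invariant i I) \/ sym_invariant I) :
  exists (A M L : nat) (B : int),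
    [/\ (A <= c)%N,
        (\forall n \near \oo, exists2 d : nat,
           krull_dim {ideal_quot (I n)} d & d%:Z = A%:Z * n%:Z + B)
      & exists2 deg : nat -> int,
          (forall n, (1 <= n)%N -> ideal_degree (I n) (deg n))
        & exists2 q : rat, 0 < q
          & (fun n : nat => (deg n)%:~R / (M ^ n * n ^ L)%N%:R : R) @ \oo
              --> (ratr q : R)].
Proof.
have [i inv] : exists i, inc_invariant i I.
  by case: hinv => // /sym_inc_invariant; exists 0%N.
have [h [[ph gh] Hh]] := inc_filtration_good inv.
have nz n : (i < n)%N -> exists d e, hilbert_pole (h n) d e.
  by move=> ni; have [c' pc] := ph n; apply: standard_pole (Hh n ni) pc.
case: gh => [[n0 h0]|[A [B [E [n0 [Ac eE HE]]]]]].
  (* An eventually zero family contradicts the poles of [h n] for [n > i]: the numerator would be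
     zero, while its value at 1 is positive. *)
  have [|d [e [e0 [g [g1 Hg]]]]] := nz (i.+1 + n0)%N; first by rewrite leq_addr.
  have gz : g = 0.
    apply/polyP => k; rewrite -Hg coef0 /conv big1 // => s _.
    by rewrite h0 ?leq_addl // mulr0.
  by move: g1 e0; rewrite gz horner0 => /esym/eqP; rewrite eqz_nat => /eqP->.
(* Past [i.+1 + n0] the degree is the leading coefficient [E n]; for smaller [n] it is taken from
   [standard_hilbert]. *)
have /choice[deg Hdeg] : forall n, exists z : int,
    ((1 <= n)%N -> ideal_degree (I n) z) /\
    ((i.+1 + n0 <= n)%N -> [/\ exists2 d : nat, krull_dim {ideal_quot (I n)} d & d%:Z = A%:Z * n%:Z + B,
       0 < E n & z%:~R = E n]).
  move=> n; case: (leqP (i.+1 + n0)%N n) => nn.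
    have ni : (i < n)%N by lia.
    have [|d [e [pole dE eEn]]] := HE n; first by lia.
    have gI : graded_ideal (I n) by apply: hgraded; lia.
    exists e%:Z; split=> _; first exact: (ideal_degree_pole gI (Hh n ni) pole).
    split; first by exists d => //; exact: (krull_dim_pole gI (Hh n ni) pole).
      by rewrite -eEn ltr0n; case: pole.
    by rewrite -eEn pmulrn.
  have [h' [d [e [Hh' pole]]]] := standard_hilbert (I n).
  exists e%:Z; split=> [n1|//].
  exact: (ideal_degree_pole (hgraded n n1) Hh' pole).
have [|M [L [q [q0 lim]]]] := @expoly_limit R E deg (i.+1 + n0)%N eE.
  by move=> n nn; have [_ /(_ nn)[_ ? ?]] := Hdeg n.
exists A, M, L, B; split=> //.
  by exists (i.+1 + n0)%N => // n /= nn; have [_ /(_ nn)[]] := Hdeg n.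
exists deg; first by move=> n n1; apply: (Hdeg n).1.
by exists q.
Qed.
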